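(* Let $P^n$ be a simple polytope with $m$ facets and let $J=(j_1,\ldots,j_m)$ be a sequence of positive integers. If $\lambda$ is a characteristic map for a $2n$-dimensional toric manifold $M$ over $P^n$, then $\lambda(J)$ is the characteristic map for a toric manifold $M(J)$ (over the simple polytope $P(J)$) of dimension $2d(J)-2m+2n$.
   Context: A simple polytope $P^n$ is an $n$-dimensional polytope in which exactly $n$ facets meet at each vertex. A simplicial complex $K$ is dual to $\partial P^n$ if its vertices $v_1,\ldots,v_m$ correspond to the facets $F_1,\ldots,F_m$ of $P^n$ and a set of vertices is a simplex exactly when the corresponding facets have nonempty common intersection. A characteristic map (function) for $P^n$ is a map $\lambda$ from facets of $P^n$ to $\mathbb{Z}^n$ such that whenever $F=F_{i_1}\cap\cdots\cap F_{i_l}$ is a codimension-$l$ face, $\lambda(F_{i_1}),\ldots,\lambda(F_{i_l})$ span a rank-$l$ direct summand of $\mathbb{Z}^n$; equivalently, regarded as an $n\times m$ integer matrix $(\lambda_{ki})$ with columns $\lambda(F_i)$, all $n\times n$ minors corresponding to vertices of $P^n$ are $\pm1$. The toric manifold of $(P^n,\lambda)$ is $M^{2n}=T^n\times P^n/\!\sim$, where $(g,p)\sim(h,q)$ iff $p=q$ and $g^{-1}h\in G_{F(p)}$; here $F(p)=F_{i_1}\cap\cdots\cap F_{i_l}$ is the face with $p$ in its relative interior and $G_{F(p)}\subset T^n$ is the $l$-dimensional subtorus whose Lie algebra is spanned by $\lambda(F_{i_1}),\ldots,\lambda(F_{i_l})$. Put $d(J)=j_1+\cdots+j_m$. $K(J)$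 is the simplicial complex on vertices $v_{it}$ ($1\le i\le m$, $1\le t\le j_i$) whose minimal non-faces (non-simplices all of whose proper subsets are simplices) are exactly the sets $\{v_{i_11},\ldots,v_{i_1j_{i_1}},\ldots,v_{i_k1},\ldots,v_{i_kj_{i_k}}\}$ with $\{v_{i_1},\ldots,v_{i_k}\}$ a minimal non-face of $K$. It is dual to the boundary of a simple polytope $P(J)$ of dimension $d(J)-m+n$ with $d(J)$ facets; the facets of $P(J)$ are thus indexed by the $v_{it}$. $\lambda(J):\mathbb{Z}^{d(J)}\to\mathbb{Z}^{d(J)-m+n}$ is the $(d(J)-m+n)\times d(J)$ integer matrix, columns indexed by the $v_{it}$, with rows: for each $i$ and each $t=2,\ldots,j_i$, a row with $1$ in column $v_{it}$, $-1$ in column $v_{i1}$ and $0$ elsewhere; and for each $k=1,\ldots,n$ a row with $\lambda_{ki}$ in column $v_{i1}$ ($i=1,\ldots,m$) and $0$ elsewhere. *)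

(* Defs.v *)
From HB Require Import structures.
From mathcomp Require Import all_boot all_order all_algebra.
From mathcomp Require Import all_classical all_reals all_analysis.
From mathcomp Require Import ring.

Set Implicit Arguments.
Unset Strict Implicit.
Unset Printing Implicit Defensive.

Import Order.TTheory GRing.Theory Num.Theory.
Import numFieldNormedType.Exports.

Local Open Scope classical_set_scope.
Local Open Scope ring_scope.

Section Polytopes.
Context {R : realType} {D : nat}.
Implicit Types (P G : set 'rV[R]_D).

Definition polytope P : Prop :=
  bounded_set P /\
  exists (k : nat) (A : 'M[R]_(D, k)) (b : 'rV[R]_k),
    P = [set x | forall i, 0 <= (x *m A + b) 0 i].

(** [has_dim G d]: the affine hull of [G] has dimension [d], i.e. it is
    [x0 + <rows of B>] for some [x0] and independent [row i B], with all the
    points [x0], [x0 + row i B] in [G]. In particular [G] is nonempty. *)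
Definition has_dim G (d : nat) : Prop :=
  exists (x0 : 'rV[R]_D) (B : 'M[R]_(d, D)),
    [/\ row_free B, G x0, forall i, G (x0 + row i B)
      & forall x, G x -> (x - x0 <= B)%MS].

(** Intersections of [P] with a supporting hyperplane ([a = 0] is allowed, so
    that the empty set and [P] itself are faces). *)
Definition face P G : Prop :=
  exists (a : 'cV[R]_D) (b : R),
    (forall x, P x -> 0 <= (x *m a) 0 0 + b) /\
    G = P `&` [set x | (x *m a) 0 0 + b = 0].

Definition codim_face P (n l : nat) G : Prop :=
  face P G /\ exists d : nat, has_dim G d /\ (d + l)%N = n.

Definition facet P (n : nat) G : Prop := codim_face P n 1 G.

Definition vertex P (v : 'rV[R]_D) : Prop := face P [set v].

Definition facets_at m (F : 'I_m -> set 'rV[R]_D) (p : 'rV[R]_D) :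
  {set 'I_m} := [set i | `[< F i p >]]%SET.

(** The common intersection in [P] of a set of facets ([P] if there are none). *)
Definition facets_meet m P (F : 'I_m -> set 'rV[R]_D) (s : {set 'I_m}) :
  set 'rV[R]_D := P `&` [set x | forall i, i \in s -> F i x].

(** [P] is an [n]-dimensional simple polytope whose [m] facets are, without
    repetition, the [F i]. *)
Definition simple_polytope (n m : nat) P (F : 'I_m -> set 'rV[R]_D) : Prop :=
  [/\ polytope P /\ has_dim P n,
      injective F,
      forall G, facet P n G <-> exists i, G = F i
    & forall v, vertex P v -> #|facets_at F v| = n].

Definition dual_to m (K : {set {set 'I_m}}) P (F : 'I_m -> set 'rV[R]_D) :
  Prop := forall s : {set 'I_m}, s \in K <-> facets_meet P F s !=set0.

End Polytopes.

Definition subgroup (V : zmodType) (S : set V) : Prop :=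
  S 0 /\ forall x y, S x -> S y -> S (x - y).

Definition direct_summand (V : zmodType) (S : set V) : Prop :=
  subgroup S /\
  exists C : set V, [/\ subgroup C, S `&` C = [set 0]
    & forall x, exists y z, [/\ S y, C z & x = y + z]].

Definition zspan (n l : nat) (A : 'M[int]_(n, l)) : set 'cV[int]_n :=
  [set A *m c | c in [set: 'cV[int]_l]].

Definition spans_summand_of_rank (n l r : nat) (A : 'M[int]_(n, l)) : Prop :=
  direct_summand (zspan A) /\
  \rank (map_mx intr A : 'M[rat]_(n, l)) = r.

Definition columns (n m : nat) (lam : 'M[int]_(n, m)) (s : {set 'I_m}) :
  'M[int]_(n, #|s|) := colsub (fun i : 'I_#|s| => enum_val i) lam.

(** The map sending the facet [F i] to column [i] of [lam]. *)
Definition characteristic_map (R : realType) (D n m : nat)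
    (P : set 'rV[R]_D) (F : 'I_m -> set 'rV[R]_D) (lam : 'M[int]_(n, m)) :
  Prop :=
  forall s : {set 'I_m}, codim_face P n #|s| (facets_meet P F s) ->
    spans_summand_of_rank #|s| (columns lam s).

Section Torus.
Context {R : realType} {n : nat}.

(** [T^n = (S^1)^n]: row [k] of [g] is the [k]-th coordinate of [g], the
    complex number [g k 0 + i g k 1]. *)
Definition torus : set 'M[R]_(n, 2) :=
  [set g | forall k, g k 0 ^+ 2 + g k 1 ^+ 2 = 1].

Definition tmul (g h : 'M[R]_(n, 2)) : 'M[R]_(n, 2) :=
  \matrix_(k, c) if c == 0 then g k 0 * h k 0 - g k 1 * h k 1
                 else g k 0 * h k 1 + g k 1 * h k 0.

(** Complex conjugation, the inverse on [torus]. *)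
Definition tinv (g : 'M[R]_(n, 2)) : 'M[R]_(n, 2) :=
  \matrix_(k, c) if c == 0 then g k 0 else - g k 1.

(** The exponential map of [T^n], with kernel [Z^n]. *)
Definition texp (u : 'cV[R]_n) : 'M[R]_(n, 2) :=
  \matrix_(k, c) if c == 0 then cos (2 * pi * u k 0) else sin (2 * pi * u k 0).

(** The subtorus whose Lie algebra is the real span of the columns of [lam]
    with index in [s]. *)
Definition subtorus m (lam : 'M[int]_(n, m)) (s : {set 'I_m}) :
  set 'M[R]_(n, 2) :=
  [set texp (map_mx intr lam *m c)
     | c in [set c : 'cV[R]_m | forall i, i \notin s -> c i 0 = 0]].

Lemma texp0 : texp 0 = \matrix_(k, c) (c == 0)%:R.
Proof.
by apply/matrixP => k c; rewrite !mxE mulr0 cos0 sin0; case: (c == 0).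
Qed.

Lemma texpN u : texp (- u) = tinv (texp u).
Proof.
by apply/matrixP => k c; rewrite !mxE mulrN cosN sinN; case: (c == 0).
Qed.

Lemma texpD u v : texp (u + v) = tmul (texp u) (texp v).
Proof.
apply/matrixP => k c; rewrite !mxE /= mulrDr cosD sinD.
by case: (c == 0) => //; rewrite addrC.
Qed.

Lemma tmulVg g : torus g -> tmul (tinv g) g = \matrix_(k, c) (c == 0)%:R.
Proof.
move=> Tg; apply/matrixP => k c; rewrite !mxE /=; case: (c == 0).
  by rewrite mulNr opprK -!expr2 Tg.
by rewrite mulNr (mulrC (g k 0)) subrr.
Qed.

Lemma tinvM g h : tinv (tmul (tinv g) h) = tmul (tinv h) g.
Proof. by apply/matrixP => k c; rewrite !mxE /=; case: (c == 0); ring. Qed.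

Lemma tmulVgM g h l : torus h ->
  tmul (tmul (tinv g) h) (tmul (tinv h) l) = tmul (tinv g) l.
Proof.
move=> Th; apply/matrixP => k c; rewrite !mxE /=.
have {}Th : h k 0 * h k 0 = 1 - h k 1 * h k 1.
  by rewrite -(Th k) !expr2 addrK.
by case: (c == 0); ring: Th.
Qed.

Lemma subtorus1 m (lam : 'M[int]_(n, m)) s :
  subtorus lam s (\matrix_(k, c) (c == 0)%:R).
Proof. by exists 0; [move=> i _; rewrite mxE | rewrite mulmx0 texp0]. Qed.

Lemma subtorusV m (lam : 'M[int]_(n, m)) s g :
  subtorus lam s g -> subtorus lam s (tinv g).
Proof.
move=> [c cs <-]; exists (- c); last by rewrite mulmxN texpN.
by move=> i si; rewrite mxE cs ?oppr0.
Qed.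

Lemma subtorusM m (lam : 'M[int]_(n, m)) s g h :
  subtorus lam s g -> subtorus lam s h -> subtorus lam s (tmul g h).
Proof.
move=> [c cs <-] [d ds <-]; exists (c + d); last by rewrite mulmxDr texpD.
by move=> i si; rewrite mxE cs ?ds ?addr0.
Qed.

End Torus.

Section ToricSpace.
Context {R : realType} {D n m : nat}.
Variables (P : set 'rV[R]_D) (F : 'I_m -> set 'rV[R]_D) (lam : 'M[int]_(n, m)).

Local Notation TP := (set_type (@torus R n) * set_type P)%type.

(** [(g, p) ~ (h, q)] iff [p = q] and [g^-1 h] lies in [G_F(p)]. *)
Definition toric_rel (x y : TP) : bool :=
  `[< x.2 = y.2 /\
      subtorus lam (facets_at F (set_val x.2))
        (tmul (tinv (set_val x.1)) (set_val y.1)) >].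

Lemma toric_rel_refl : reflexive toric_rel.
Proof.
move=> [g p]; apply/asboolP; split=> //=.
by rewrite tmulVg; [exact: subtorus1 | exact: set_valP].
Qed.

Lemma toric_rel_sym : symmetric toric_rel.
Proof.
suff sub x y : toric_rel x y -> toric_rel y x.
  by move=> x y; apply/idP/idP; exact: sub.
move=> /asboolP[exy xy]; apply/asboolP; split=> //; rewrite -exy -tinvM.
exact: subtorusV.
Qed.

Lemma toric_rel_trans : transitive toric_rel.
Proof.
move=> y x z /asboolP[exy xy] /asboolP[eyz yz]; apply/asboolP.
split; first by rewrite exy.
rewrite -exy in yz; have Ty : torus (set_val y.1) by exact: set_valP.
by have := subtorusM xy yz; rewrite tmulVgM.
Qed.

Canonical toric_equiv :=
  EquivRel toric_rel toric_rel_refl toric_rel_sym toric_rel_trans.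

Definition toric_space : topologicalType :=
  quotient_topology {eq_quot toric_equiv}%qT.

End ToricSpace.

Definition manifold (R : realType) (k : nat) (M : topologicalType) : Prop :=
  [/\ hausdorff_space M,
      @second_countable M
    & forall x : M, exists (U : set M) (V : set 'rV[R]_k)
        (f : M -> 'rV[R]_k) (g : 'rV[R]_k -> M),
        [/\ open U /\ U x,
            open V,
            {within U, continuous f} /\ {within V, continuous g},
            forall y, U y -> V (f y) /\ g (f y) = y
          & forall z, V z -> U (g z) /\ f (g z) = z]].

Definition minimal_nonface (I : finType) (K : {set {set I}}) (s : {set I}) :
  bool := (s \notin K) && [forall t : {set I}, (t \proper s) ==> (t \in K)].

Section Wedge.
Context {m : nat}.
Variable J : 'I_m -> nat.

(** [d(J)]. The vertex [v_it] (with [t] counted from 0) is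
    [tagnat.Rank i t : 'I_dJ], and [i = tagnat.sig1 v_it]. *)
Definition dJ : nat := (\sum_i J i)%N.

Definition blowup (s : {set 'I_m}) : {set 'I_dJ} :=
  [set v : 'I_dJ | tagnat.sig1 v \in s]%SET.

(** The complex whose minimal non-faces are the [blowup t], for [t] a minimal
    non-face of [K]; see [minimal_nonface_KJ]. *)
Definition KJ (K : {set {set 'I_m}}) : {set {set 'I_dJ}} :=
  [set s : {set 'I_dJ} |
    [forall t, minimal_nonface K t ==> ~~ (blowup t \subset s)]]%SET.

Lemma KJ_sub K (s t : {set 'I_dJ}) : t \subset s -> s \in KJ K -> t \in KJ K.
Proof.
rewrite !inE => ts /forallP sK; apply/forallP => u; apply/implyP => uK.
by apply: contra (implyP (sK u) uK) => ut; exact: fintype.subset_trans ut ts.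
Qed.

Hypothesis J_gt0 : forall i, (0 < J i)%N.

Lemma blowup_subset (s t : {set 'I_m}) : (blowup s \subset blowup t) = (s \subset t).
Proof.
apply/idP/idP => /fintype.subsetP st; apply/fintype.subsetP => i; last by rewrite !inE; exact: st.
move=> si; have := st (tagnat.Rank i (Ordinal (J_gt0 i))).
by rewrite !inE tagnat.Rank1K; exact.
Qed.

Lemma minimal_nonface_KJ K s :
  minimal_nonface (KJ K) s <-> exists2 t, minimal_nonface K t & s = blowup t.
Proof.
have nonface t : minimal_nonface K t -> blowup t \notin KJ K.
  by move=> tK; rewrite inE negb_forall; apply/existsP; exists t; rewrite tK subxx.
split=> [/andP[]|[t tK ->]].
  rewrite inE negb_forall => /existsP[t]; rewrite negb_imply negbK => /andP[tK ts].
  move=> /forallP/(_ (blowup t))/implyP sK; exists t => //.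
  apply/eqP; rewrite finset.eqEsubset ts andbT; apply: contraNT (nonface t tK) => st.
  by apply: sK; rewrite properE ts.
rewrite /minimal_nonface nonface //=; apply/forallP => u; apply/implyP => ut.
rewrite inE; apply/forallP => t'; apply/implyP => t'K; apply/negP => t'u.
have /andP[_ /forallP/(_ t')/implyP] := tK; have /andP[/negP t'K' _] := t'K.
move=> tt'; apply: t'K'; apply: tt'.
have := sub_proper_trans t'u ut; by rewrite !properE !blowup_subset.
Qed.

Lemma dJ_rows n : (\sum_i (J i).-1 + n = dJ - m + n)%N.
Proof.
have dE : (\sum_i (J i).-1 + m = dJ)%N.
  rewrite -[X in (_ + X)%N](card_ord m) -sum1_card -big_split /=.
  by apply: eq_bigr => i _; rewrite addn1 prednK.
by rewrite -dE addnK.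
Qed.

(** The rows are first, for each [i], those with a [1] in column [v_it],
    [t = r + 1 > 0], and [-1] in column [v_i0]; then those of [lam] spread over
    the columns [v_i0]. The cast rewrites the number of rows as [d(J) - m + n]. *)
Definition lambdaJ n (lam : 'M[int]_(n, m)) : 'M[int]_(dJ - m + n, dJ) :=
  castmx (dJ_rows n, erefl)
    (col_mx
      (\mxblock_(i < m, i' < m)
        \matrix_(r < (J i).-1, t < J i')
          if i == i' then (t == r.+1 :> nat)%:R - (t == 0 :> nat)%:R else 0)
      (\mxrow_(i < m)
        \matrix_(k < n, t < J i) if t == 0 :> nat then lam k i else 0)).

End Wedge.

(* Main.v *)
(** A simple polytope [P] is cut out of its affine hull by affine functions
    [l_i >= 0] with [F_i = {l_i = 0}], and every point of [P] lies in the
    open star of a vertex [v], where the [n] functions [l_i] with [v] in [F_i] are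
    affine coordinates. At [v] the corresponding columns of [lam] form a basis of
    [Z^n], so [(g, p) |-> (l_i(p) theta_i(g))_i], with [theta] the automorphism of
    the torus given by the inverse matrix, identifies the open star with an open
    subset of [C^n]; compactness of [T^n * P] makes this a homeomorphism.

    For [lam(J)], a set of columns spans a direct summand of full rank if and only
    if it has a dual family of integral forms. If [s] is a simplex of [K(J)], the
    blocks [i] with all [v_it] in [s] form a simplex of [K]; forms dual to its
    columns of [lam], corrected by the coordinate forms of the vertices missing
    from the other blocks, give forms dual to the columns of [lam(J)] in [s]. *)
Require Import Defs.
From mathcomp Require Import all_boot all_order all_algebra.
From mathcomp Require Import all_classical all_reals all_analysis.
From mathcomp Require Import ring lra.

Set Implicit Arguments.
Unset Strict Implicit.
Unset Printing Implicit Defensive.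

Import Order.TTheory GRing.Theory Num.Theory.
Import numFieldNormedType.Exports.

Local Open Scope classical_set_scope.
Local Open Scope ring_scope.

(** * Manifolds from compact charts *)

Lemma continuous_mx (T U : topologicalType) m n (f : T -> 'M[U]_(m, n)) :
  (forall i j, continuous (fun x => f x i j)) -> continuous f.
Proof.
move=> fc x A [B Bf BA].
have : \forall y \near x, forall i j, B i j (f y i j).
  by apply: filter_forall => i; apply: filter_forall => j; exact: (fc i j x _ (Bf i j)).
by apply: filterS => y By; exact: BA.
Qed.

Lemma continuous_sum (R : realType) (T : topologicalType) (I : Type)
    (r : seq I) (Q : pred I) (f : I -> T -> R) :
  (forall i, continuous (f i)) ->
  continuous (fun x => \sum_(i <- r | Q i) f i x).
Proof. by move=> fc; apply: continuous_big => //; exact: add_continuous. Qed.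

Lemma ex_rat_ball (R : realType) k (z : 'rV[R]_k) (r : R) : 0 < r ->
  exists q : 'rV[rat]_k, ball (map_mx (@ratr R) q) r z.
Proof.
move=> r0.
have ex i : exists q : rat, ball (ratr q : R) r (z 0 i).
  have [|q qz] := @rat_in_itvoo R (z 0 i - r) (z 0 i + r).
    by rewrite ltrD2l (lt_trans _ r0)// oppr_lt0.
  by exists q; rewrite /ball /= ltr_distl; rewrite in_itv in qz.
exists (\row_i projT1 (cid (ex i))); split => // i j.
by rewrite !mxE ord1; exact: (projT2 (cid (ex j))).
Qed.

Section CompactCharts.
Variables (R : realType) (k : nat) (M E : topologicalType) (I : finType).
Variables (f : I -> M -> E) (e : I -> E -> 'rV[R]_k) (h : I -> 'rV[R]_k -> E).
Variables (U : I -> set M) (V : I -> set 'rV[R]_k).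
Hypothesis M_compact : compact [set: M].
Hypothesis E_hausdorff : hausdorff_space E.
Hypothesis f_cont : forall i, continuous (f i).
Hypothesis e_cont : forall i x, U i x -> {for f i x, continuous (e i)}.
Hypothesis h_cont : forall i, continuous (h i).
Hypothesis U_open : forall i, open (U i).
Hypothesis V_open : forall i, open (V i).
Hypothesis U_chart : forall i x, U i x -> V i (e i (f i x)) /\ h i (e i (f i x)) = f i x.
Hypothesis V_chart : forall i z, V i z -> e i (h i z) = z /\ exists2 x, U i x & f i x = h i z.
Hypothesis f_sep : forall i x y, U i x -> f i x = f i y -> x = y.
Hypothesis U_cover : forall x, exists i, U i x.

(* The image of a closed set under [f i] is compact, hence closed; so the
   inverse [V i -> U i] of the chart is continuous although [U i] itself need
   not be compact. *)
Lemma closed_image i (C : set M) : closed C -> closed (f i @` C).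
Proof.
move=> Cc; apply: compact_closed => //.
apply: continuous_compact; first exact: continuous_subspaceT.
exact: subclosed_compact Cc M_compact _.
Qed.

(** This is the image of [U i] intersected with [W] under the chart [e i \o f i], since [V_chart]
    and [f_sep] give each point of [V i] exactly one preimage. Excluding the image of the complement
    of [W], a closed set, makes openness visible. *)
Definition chart_image i (W : set M) := V i `&` h i @^-1` (~` (f i @` (~` W))).

Lemma open_chart_image i (W : set M) : open W -> open (chart_image i W).
Proof.
move=> Wo; apply: openI => //; apply: open_comp; first by move=> z _; exact: h_cont.
by rewrite openC; apply: closed_image; exact: open_closedC.
Qed.

Lemma chart_imageE i (W : set M) z : chart_image i W z <->
  V i z /\ forall x, f i x = h i z -> W x.
Proof.
split=> -[Vz H]; split=> //.
  by move=> x fx; apply: contrapT => nW; apply: H; exists x.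
by move=> [x nW fx]; exact: nW (H _ fx).
Qed.

Lemma chart_image_self i (W : set M) x : U i x -> W x ->
  chart_image i W (e i (f i x)).
Proof.
move=> Ux Wx; have [Vx hx] := U_chart Ux; apply/chart_imageE; split=> // y.
by rewrite hx => /esym/(f_sep Ux) <-.
Qed.

Lemma chart_cont i x : U i x -> {for x, continuous (e i \o f i)}.
Proof. by move=> Ux; apply: continuous_comp; [exact: f_cont|exact: e_cont]. Qed.

(** In [f_sep] only [x] has to lie in [U i], so the single map [f i] separates [x] from every other
    point of [M], inside the Hausdorff space [E]. *)
Lemma compact_charts_hausdorff : hausdorff_space M.
Proof.
move=> x y xy; have [i Ux] := U_cover x; apply: (f_sep Ux).
apply: E_hausdorff => A B Ax By.
have [z [Az Bz]] := xy _ _ (f_cont (i:=i) Ax) (f_cont (i:=i) By).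
by exists (f i z).
Qed.

(** The countable base consists of the pullbacks, through the finitely many charts, of balls with
    rational centre and radius the inverse of a positive integer. *)
Lemma compact_charts_second_countable : @second_countable M.
Proof.
pose b (c : I * 'rV[rat]_k * nat) : set M :=
  U c.1.1 `&` ((e c.1.1 \o f c.1.1) @^-1` (ball (map_mx (@ratr R) c.1.2) c.2.+1%:R^-1)°).
exists (range b); first exact: sub_countable (card_image_le _ _) (countableP _).
split.
  move=> _ [[[i q] r] _ <-]; rewrite openE => x [/= Ux fx].
  apply: filterI; first by apply: open_nbhs_nbhs; split.
  by apply: (chart_cont Ux); apply: open_nbhs_nbhs; split => //; exact: open_interior.
move=> x A; rewrite nbhsE => -[W [Wo Wx] WA].
have [i Ux] := U_cover x.
have : nbhs (e i (f i x)) (chart_image i W).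
  by apply: open_nbhs_nbhs; split; [exact: open_chart_image|exact: chart_image_self].
move=> /nbhs_ballP[d /= d0 dW].
have [r rd] : exists r : nat, r.+1%:R^-1 < d / 2.
  by have [r] := @ltr_add_invr R 0 (d / 2) (divr_gt0 d0 (ltr0Sn R 1)); rewrite add0r; exists r.
have r0 : (0 : R) < r.+1%:R^-1 by rewrite invr_gt0.
(* Half the radius is used so that the image of [x] is interior to the ball around [q]; the whole
   ball then stays within [d] of that image because its radius is below [d / 2]. *)
have [q qx] := ex_rat_ball (e i (f i x)) (divr_gt0 r0 (ltr0Sn R 1)).
exists (b (i, q, r)).
  split; first by exists (i, q, r).
  split=> //=; apply/nbhs_ballP; exists (r.+1%:R^-1 / 2) => /=.
    exact: divr_gt0.
  by move=> y xy; rewrite [r.+1%:R^-1]splitr; exact: ball_triangle qx xy.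
move=> y [/= Uy fy]; apply: WA.
have /dW/chart_imageE[_] : ball (e i (f i x)) d (e i (f i y)).
  rewrite [d]splitr; apply: (@ball_triangle _ _ (map_mx (@ratr R) q)).
    apply/ball_sym; apply: le_ball qx; apply: le_trans (ltW rd).
    by rewrite ler_pdivrMr// ler_peMr ?ler1n// ltW.
  by apply: le_ball (interior_subset fy); exact: ltW.
by apply; rewrite (U_chart Uy).2.
Qed.

Lemma compact_charts_manifold : manifold R k M.
Proof.
split; [exact: compact_charts_hausdorff|exact: compact_charts_second_countable|].
move=> x; have [i Ux] := U_cover x.
(* The inverse chart picks the preimage in [U i]; off [V i] it may take the default value [x]. *)
pose g z := xget x [set y | U i y /\ f i y = h i z].
have gP z : V i z -> U i (g z) /\ f i (g z) = h i z.
  move=> /V_chart[_ [y Uy fy]].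
  by apply: (@xgetPex _ x [set y | U i y /\ f i y = h i z]); exists y.
exists (U i), (V i), (e i \o f i), g; split=> //; last 2 first.
- move=> y Uy; have [Vy hy] := U_chart Uy; split=> //.
  by have [Ug fg] := gP _ Vy; apply: f_sep Ug _; rewrite fg.
- by move=> z Vz; have [Ug fg] := gP _ Vz; rewrite /= fg (V_chart Vz).1.
split; apply: continuous_in_subspaceT => z; rewrite inE => Vz; first exact: chart_cont.
move=> A; rewrite nbhsE => -[W [Wo Wg] WA].
have [Ugz fgz] := gP _ Vz.
have : nbhs z (chart_image i W).
  apply: open_nbhs_nbhs; split; first exact: open_chart_image.
  by have := chart_image_self Ugz Wg; rewrite fgz (V_chart Vz).1.
apply: filterS => w /chart_imageE[Vw wW]; apply: WA; apply: wW.
by have [] := gP _ Vw.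
Qed.

End CompactCharts.

(** * Tori *)

Lemma injective_hausdorff (T U : topologicalType) (f : T -> U) :
  hausdorff_space U -> continuous f -> injective f -> hausdorff_space T.
Proof.
move=> hU fc finj x y xy; apply: finj; apply: hU => A B Ax By.
have [z [Az Bz]] := xy _ _ (fc _ _ Ax) (fc _ _ By).
by exists (f z).
Qed.

Lemma set_val_continuous (T : topologicalType) (A : set T) :
  continuous (set_val : set_type A -> T).
Proof. exact: initial_continuous. Qed.

Lemma continuous_set_type (T U : topologicalType) (A : set U) (f : T -> set_type A) :
  continuous (fun x => set_val (f x)) -> continuous f.
Proof.
move=> fc x B; rewrite nbhsE => -[_ [[W Wo <-] /= Wx] WB].
have : nbhs x ((fun y => set_val (f y)) @^-1` W).
  by apply: fc; apply: open_nbhs_nbhs; split.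
by apply: filterS => y Wy; exact: WB.
Qed.

Lemma compact_set_type (T : topologicalType) (A : set T) :
  compact A -> compact [set: set_type A].
Proof.
move=> Ac F FF _; pose G := (set_val : set_type A -> T) @ F.
have GA : G A by rewrite /G /=; apply: (@filterE _ F) => x; exact: set_valP.
have [x [Ax xG]] := Ac G _ GA.
exists (exist _ x (mem_set Ax)); split=> // B C FB; rewrite nbhsE => -[_ [[W Wo <-] /= Wx] WC].
have [||_ [[y By <-] Wy]] := xG ((set_val : set_type A -> T) @` B) W; last 1 first.
- by exists y; split => //; exact: WC.
- by rewrite /G /=; apply: (@filterS _ F _ B) => // y By; exists y.
- exact: open_nbhs_nbhs.
Qed.

(** A continuous surjection from a compact space to a Hausdorff space is closed, so the preimage of
    a closed set under [f] is the image under [e] of a closed set. *)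
Lemma compact_lift_continuous (X Y Z : topologicalType) (e : X -> Y) (f : Y -> Z) :
  compact [set: X] -> hausdorff_space Y -> continuous e ->
  (forall y, exists x, e x = y) -> continuous (f \o e) -> continuous f.
Proof.
move=> Xc Yh ec es /continuous_closedP fec; apply/continuous_closedP => C Cc.
have -> : f @^-1` C = e @` ((f \o e) @^-1` C).
  apply/seteqP; split=> [y Cy|_ [x Cx <-] //].
  by have [x xy] := es y; exists x => //=; rewrite xy.
apply: compact_closed => //.
apply: continuous_compact; first exact: continuous_subspaceT.
by apply: subclosed_compact Xc _ => //; exact: fec.
Qed.

(** * Angles on the unit circle *)

Section Circle.
Variable R : realType.

Lemma circle_angle (c s : R) : c ^+ 2 + s ^+ 2 = 1 ->
  exists2 t, 0 <= t <= 1 & cos (2 * pi * t) = c /\ sin (2 * pi * t) = s.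
Proof.
move=> cs; have c1 : -1 <= c <= 1.
  have : 0 <= s ^+ 2 by exact: sqr_ge0.
  by move: cs; rewrite !expr2 => *; apply/andP; split; nra.
have p0 : (0 : R) < 2 * pi by rewrite mulr_gt0 ?pi_gt0.
have sE : Num.sqrt (1 - c ^+ 2) = `|s| by rewrite -cs addrC addKr sqrtr_sqr.
have a0 := acos_ge0 c1; have api := acos_lepi c1.
have pp := pi_gt0 R.
have [q0 q1] : 0 <= acos c / (2 * pi) /\ acos c / (2 * pi) <= 1.
  split; first by rewrite divr_ge0// ltW.
  by rewrite ler_pdivrMr// mul1r (le_trans api)//; lra.
(* [acos] only reaches the upper half circle; on the lower half the angle is reflected to
   [1 - acos c / (2 * pi)]. *)
have [s0|s0] := leP 0 s.
  exists (acos c / (2 * pi)); first by rewrite q0.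
  rewrite mulrC divfK ?gt_eqF// acosK ?in_itv//=; split=> //.
  by rewrite sin_acos// sE ger0_norm.
exists (1 - acos c / (2 * pi)); first by apply/andP; split; lra.
rewrite mulrBr mulr1 (mulrC (2 * pi) (_ / _)) divfK ?gt_eqF//.
rewrite cosB sinB mulr_natl cos2pi sin2pi !mul0r !mul1r addr0 sub0r.
by rewrite acosK ?in_itv//= sin_acos// sE ltr0_norm// opprK.
Qed.

Lemma cos_sin_int (z : int) : cos (2 * pi * z%:~R) = 1 :> R /\ sin (2 * pi * z%:~R) = 0 :> R.
Proof.
have nat n : cos (2 * pi * n%:R) = 1 :> R /\ sin (2 * pi * n%:R) = 0 :> R.
  have E : 2 * pi * n%:R = 0 + (pi *+ 2) *+ n :> R.
    by rewrite mulr_natl add0r mulr_natr.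
  by rewrite E (periodicn (@cosD2pi R)) (periodicn (@sinD2pi R)) cos0 sin0.
case: z => n; first exact: nat.
by rewrite NegzE mulrNz mulrN cosN sinN (nat n.+1).1 (nat n.+1).2 oppr0.
Qed.

Lemma cos_eq1_int (t : R) : cos (2 * pi * t) = 1 -> exists z : int, t = z%:~R.
Proof.
move=> ct; exists (Num.floor t); pose u := t - (Num.floor t)%:~R.
have [u0 u1] : 0 <= u /\ u < 1.
  by have /andP[] := floor_itv t; rewrite /u intrD; split; lra.
have cu : cos (2 * pi * u) = 1.
  rewrite mulrBr cosB ct; have [-> ->] := cos_sin_int (Num.floor t).
  by rewrite mulr0 addr0 mulr1.
have p0 := pi_gt0 R; apply/eqP; rewrite -subr_eq0 -/u; apply/eqP.
have itv0 : (0 : R) \in `[0, pi] by rewrite in_itv/= lexx ltW.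
have [u2|u2] := leP u 2^-1.
  have : 2 * pi * u = 0.
    apply: (@cos_inj R) => //; last by rewrite cu cos0.
    by rewrite in_itv/=; apply/andP; split; nra.
  by move=> /eqP; rewrite mulf_eq0 gt_eqF ?mulr_gt0//= => /eqP.
(* For [u] above one half the angle is reflected into the interval where [cos] is injective; this
   forces [u = 1], against [u < 1]. *)
have : 2 * pi * (1 - u) = 0.
  apply: (@cos_inj R) => //; last first.
    by rewrite mulrBr mulr1 cosB mulr_natl cos2pi sin2pi -mulr_natl cu mul0r addr0 mulr1 cos0.
  by rewrite in_itv/=; apply/andP; split; nra.
by move=> /eqP; rewrite mulf_eq0 gt_eqF ?mulr_gt0//= subr_eq0 => /eqP ?; lra.
Qed.

End Circle.

(** * The exponential map and integral homomorphisms of tori *)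

Section TorusHom.
Variable R : realType.

Lemma torus_texp n (u : 'cV[R]_n) : torus (texp u).
Proof. by move=> k; rewrite !mxE /= cos2Dsin2. Qed.

Lemma texp_coord n (u v : 'cV[R]_n) k c : u k 0 = v k 0 -> texp u k c = texp v k c.
Proof. by rewrite !mxE => ->. Qed.

Lemma texp_eq1 n (u : 'cV[R]_n) : texp u = texp 0 ->
  exists z : 'cV[int]_n, u = map_mx intr z.
Proof.
move=> u1; have ex k : exists z : int, u k 0 = z%:~R.
  apply: cos_eq1_int; have /matrixP/(_ k 0) := u1.
  by rewrite !mxE /= mulr0 cos0.
exists (\col_k projT1 (cid (ex k))); apply/colP => k.
by rewrite !mxE; exact: projT2 (cid (ex k)).
Qed.

Lemma texp_int n (z : 'cV[int]_n) : texp (map_mx intr z) = texp 0 :> 'M[R]_(n, 2).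
Proof.
apply/matrixP => k c; rewrite !mxE mulr0 cos0 sin0.
by have [-> ->] := cos_sin_int R (z k 0).
Qed.

Lemma tmul0 n (g : 'M[R]_(n, 2)) : tmul g (texp 0) = g.
Proof.
apply/matrixP => k c; rewrite !mxE /= mulr0 cos0 sin0 !mulr0 !mulr1 subr0 add0r.
by case: ifP => [/eqP->//|]; case: c => [[|[|//]]] // i _; congr (g k _); apply/val_inj.
Qed.

Lemma texpB_int n (u v : 'cV[R]_n) : texp u = texp v <->
  exists z : 'cV[int]_n, u - v = map_mx intr z.
Proof.
split=> [uv|[z uvz]].
  apply: texp_eq1; rewrite texpD texpN uv -texpN -texpD subrr //.
by rewrite -(subrK v u) addrC uvz texpD texp_int tmul0.
Qed.

Lemma texp_surj n (g : 'M[R]_(n, 2)) : torus g ->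
  exists2 u : 'cV[R]_n, (forall k, 0 <= u k 0 <= 1) & texp u = g.
Proof.
move=> Tg; have ex k := circle_angle (Tg k).
exists (\col_k projT1 (cid2 (ex k))) => [k|].
  by rewrite mxE; case: cid2.
apply/matrixP => k c; rewrite !mxE; case: cid2 => t /= _ [-> ->].
by case: ifP => [/eqP->//|]; case: c => [[|[|//]]] // i _; congr (g k _); apply/val_inj.
Qed.

Lemma texp_continuous n : continuous (@texp R n).
Proof.
apply: continuous_mx => k c u.
have cu : {for u, continuous (fun u : 'cV[R]_n => 2 * pi * u k 0)}.
  by apply: continuousM; [exact: cst_continuous|exact: coord_continuous].
have -> : (fun x : 'cV[R]_n => texp x k c) =
    if c == 0 then (fun x => cos (2 * pi * x k 0)) else (fun x => sin (2 * pi * x k 0)).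
  by apply/funext => x; rewrite mxE; case: ifP.
by case: ifP => _; apply: continuous_comp => //; [exact: continuous_cos|exact: continuous_sin].
Qed.

Definition tlog n (g : 'M[R]_(n, 2)) : 'cV[R]_n := xget 0 [set u | texp u = g].

Lemma tlogK n (g : 'M[R]_(n, 2)) : torus g -> texp (tlog g) = g.
Proof. by move=> /texp_surj[u _ ug]; apply: (@xgetPex _ 0 [set u | texp u = g]); exists u. Qed.

(* The homomorphism of tori with differential [L]: since [L] is integral, it does
   not depend on the choice of [tlog g] (and it is junk off the torus). *)
Definition thom n n' (L : 'M[int]_(n', n)) (g : 'M[R]_(n, 2)) : 'M[R]_(n', 2) :=
  texp (map_mx intr L *m tlog g).

Lemma thom_texp n n' (L : 'M[int]_(n', n)) (u : 'cV[R]_n) :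
  thom L (texp u) = texp (map_mx intr L *m u).
Proof.
have /texpB_int[z uz] := tlogK (torus_texp u).
by apply/texpB_int; exists (L *m z); rewrite -mulmxBr uz map_mxM.
Qed.

(** [texp] restricted to this compact cube is still onto the torus; compactness of the torus and
    continuity of [thom] are both drawn from it. *)
Definition unit_cube n : set 'rV[R]_n := [set u | forall k, 0 <= u 0 k <= 1].

Lemma compact_unit_cube n : compact (@unit_cube n).
Proof.
have := @rV_compact R n (fun=> `[0, 1]%classic) (fun=> @segment_compact R 0 1).
congr compact; apply/seteqP; split=> u /= uP k; have := uP k; by rewrite in_itv.
Qed.

Definition cube_torus n (u : set_type (@unit_cube n)) : set_type (@torus R n) :=
  exist _ (texp (set_val u)^T) (mem_set (torus_texp _)).

Lemma cube_torus_surj n g : exists u, @cube_torus n u = g.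
Proof.
case: g => g gT; have [u u01 ug] := texp_surj (set_mem gT).
have uc : unit_cube u^T by move=> k; rewrite mxE.
exists (exist _ u^T (mem_set uc)); apply/val_inj; rewrite /= -[RHS]ug.
by rewrite set_valE /= trmxK.
Qed.

Lemma trmx_continuous m n : continuous (@trmx R m n).
Proof.
apply: continuous_mx => i j.
have -> : (fun x : 'M[R]_(m, n) => x^T i j) = (fun x => x j i).
  by apply/funext => x; rewrite mxE.
exact: coord_continuous.
Qed.

Lemma cube_torus_continuous n : continuous (@cube_torus n).
Proof.
apply: continuous_set_type => u.
apply: (@continuous_comp _ _ _ (fun u : set_type (@unit_cube n) => (set_val u)^T) (@texp R n));
  last exact: texp_continuous.
apply: (@continuous_comp _ _ _ (set_val : set_type (@unit_cube n) -> _) trmx).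
  exact: set_val_continuous.
exact: trmx_continuous.
Qed.

Lemma compact_torus n : compact [set: set_type (@torus R n)].
Proof.
have -> : [set: set_type (@torus R n)] = @cube_torus n @` setT.
  by apply/seteqP; split=> // g _; have [u ug] := cube_torus_surj g; exists u.
apply: continuous_compact; first exact/continuous_subspaceT/cube_torus_continuous.
exact/compact_set_type/compact_unit_cube.
Qed.

Lemma mulmx_continuous m n p (A : 'M[R]_(m, n)) : continuous (@mulmx R m n p A).
Proof.
apply: continuous_mx => i j.
have -> : (fun x : 'M[R]_(n, p) => (A *m x) i j) = (fun x => \sum_k A i k * x k j).
  by apply/funext => x; rewrite mxE.
apply: continuous_sum => k x; apply: continuousM; [exact: cst_continuous|exact: coord_continuous].
Qed.

(** [tlog] is an arbitrary choice of logarithm and need not be continuous. Composed with the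
    surjection from the cube, however, [thom L] becomes [texp] after a linear map, and continuity
    descends. *)
Lemma thom_continuous n n' (L : 'M[int]_(n', n)) :
  continuous (fun g : set_type (@torus R n) => thom L (set_val g)).
Proof.
apply: (compact_lift_continuous _ _ (@cube_torus_continuous n) (@cube_torus_surj n)).
- exact/compact_set_type/compact_unit_cube.
- apply: (injective_hausdorff _ (@set_val_continuous _ _)); first exact: norm_hausdorff.
  by move=> x y; rewrite !set_valE => /val_inj.
have -> : (fun g : set_type (@torus R n) => thom L (set_val g)) \o @cube_torus n =
    (@texp R n') \o (mulmx (map_mx intr L)) \o trmx \o (set_val : set_type (@unit_cube n) -> _).
  by apply/funext => u; rewrite /= set_valE /= thom_texp.
have c1 : continuous (trmx \o (set_val : set_type (@unit_cube n) -> 'rV[R]_n)).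
  by move=> u; apply: continuous_comp; [exact: set_val_continuous|exact: trmx_continuous].
have c2 : continuous (@texp R n' \o mulmx (map_mx intr L : 'M[R]_(n', n))).
  by move=> u; apply: continuous_comp; [exact: mulmx_continuous|exact: texp_continuous].
by move=> u; exact: (continuous_comp (c1 u) (c2 _)).
Qed.

End TorusHom.

(** * Charts of toric spaces *)

Section PolarCoordinates.
Variables (R : realType) (n : nat).

(** [R^(2n)] is read as [C^n], row [j] of the unflattened matrix being the [j]-th complex number;
    these are the moduli. *)
Definition mxvec_radii (z : 'rV[R]_(n * 2)) : 'rV[R]_n :=
  \row_j Num.sqrt (vec_mx z j 0 ^+ 2 + vec_mx z j 1 ^+ 2).

Lemma mxvec_radii_ge0 z j : 0 <= mxvec_radii z 0 j.
Proof. by rewrite mxE sqrtr_ge0. Qed.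

Lemma mxvec_radiiK (t : 'rV[R]_n) (g : 'M[R]_(n, 2)) : torus g -> (forall j, 0 <= t 0 j) ->
  mxvec_radii (mxvec (\matrix_(j, c) (t 0 j * g j c))) = t.
Proof.
move=> Tg t0; apply/rowP => j; rewrite mxE mxvecK !mxE !exprMn -mulrDr Tg mulr1.
by rewrite sqrtr_sqr ger0_norm.
Qed.

Lemma polar_decomposition z : exists2 g : 'M[R]_(n, 2), torus g &
  z = mxvec (\matrix_(j, c) (mxvec_radii z 0 j * g j c)).
Proof.
pose r j := mxvec_radii z 0 j.
have r2 j : r j ^+ 2 = vec_mx z j 0 ^+ 2 + vec_mx z j 1 ^+ 2.
  by rewrite /r mxE sqr_sqrtr// addr_ge0 ?sqr_ge0.
(* Where the modulus vanishes the phase is arbitrary and is set to 1. *)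
pose g : 'M[R]_(n, 2) := \matrix_(j, c)
  if r j == 0 then (c == 0)%:R else (r j)^-1 * vec_mx z j c.
have gE j c : g j c = if r j == 0 then (c == 0)%:R else (r j)^-1 * vec_mx z j c.
  by rewrite mxE.
exists g.
  move=> j; rewrite !gE; case: eqP => [|/eqP] rj.
    by rewrite /= expr1n expr0n addr0.
  by rewrite !exprMn -mulrDr -r2 -exprMn mulVf ?expr1n.
rewrite -[LHS]vec_mxK; congr mxvec; apply/matrixP => j c; rewrite [RHS]mxE.
rewrite -/(r j) gE; case: eqP => [r0|/eqP rj]; last by rewrite mulVKf.
rewrite r0 mul0r; move: (r2 j) => /eqP; rewrite r0 expr0n/= eq_sym paddr_eq0 ?sqr_ge0//.
rewrite !sqrf_eq0 => /andP[/eqP z0 /eqP z1].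
case: c => [[|[|//]]] // i; [rewrite -[RHS]z0|rewrite -[RHS]z1]; congr (vec_mx z j _); exact/val_inj.
Qed.

Lemma vec_mx_continuous m p : continuous (@vec_mx R m p).
Proof.
apply: continuous_mx => i j.
have -> : (fun x : 'rV[R]_(m * p) => vec_mx x i j) = (fun x => x 0 (mxvec_index i j)).
  by apply/funext => x; rewrite mxE.
exact: coord_continuous.
Qed.

Lemma mxvec_continuous m p : continuous (@mxvec R m p).
Proof.
apply: continuous_mx => i j; rewrite ord1; case/mxvec_indexP: j => a b.
have -> : (fun x : 'M[R]_(m, p) => mxvec x 0 (mxvec_index a b)) = (fun x => x a b).
  by apply/funext => x; rewrite mxvecE.
exact: coord_continuous.
Qed.

Lemma mxvec_radii_continuous : continuous mxvec_radii.
Proof.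
apply: continuous_mx => i j.
have -> : (fun x => mxvec_radii x i j) = (fun x => Num.sqrt (vec_mx x j 0 ^+ 2 + vec_mx x j 1 ^+ 2)).
  by apply/funext => x; rewrite mxE.
have c1 c : continuous (fun x : 'rV[R]_(n * 2) => vec_mx x j c ^+ 2).
  move=> x; apply: (@continuous_comp _ _ _ (fun x : 'rV[R]_(n * 2) => vec_mx x j c)
    (fun y => y ^+ 2)).
    apply: (@continuous_comp _ _ _ (@vec_mx R n 2) (fun y => y j c)).
      exact: vec_mx_continuous.
    exact: coord_continuous.
  exact: exprn_continuous.
move=> x; apply: (@continuous_comp _ _ _
  (fun x : 'rV[R]_(n * 2) => vec_mx x j 0 ^+ 2 + vec_mx x j 1 ^+ 2) Num.sqrt).
  exact: cvgD (c1 0 x) (c1 1 x).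
exact: sqrt_continuous.
Qed.

End PolarCoordinates.

Section ToricCharts.
Variables (R : realType) (n m D : nat) (P : set 'rV[R]_D) (F : 'I_m -> set 'rV[R]_D).
Variables (lam : 'M[int]_(n, m)) (l : 'I_m -> 'rV[R]_D -> R).
Hypothesis P_compact : compact P.
Hypothesis l_cont : forall i, continuous (l i).
Hypothesis l_ge0 : forall i p, P p -> 0 <= l i p.
Hypothesis l_eq0 : forall i p, P p -> F i p <-> l i p = 0.

Local Notation TP := (set_type (@torus R n) * set_type P)%type.
Local Notation M := (toric_space P F lam).
Local Notation E := ('rV[R]_D * 'M[R]_(n, 2))%type.

Lemma toric_space_compact : compact [set: M].
Proof.
have -> : [set: M] = (\pi_M : TP -> M)%qT @` setT.
  by apply/seteqP; split=> // x _; exists (repr x) => //; rewrite reprK.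
apply: continuous_compact; first exact/continuous_subspaceT/pi_continuous.
rewrite -setXTT; apply: compact_setX; first exact: compact_torus.
exact: compact_set_type.
Qed.

Lemma toric_space_eqP (x y : TP) :
  (\pi_M x = \pi_M y)%qT <-> toric_rel F lam x y.
Proof. by split=> [/eqmodP|xy]; last apply/eqmodP. Qed.

Section Chart.
Variables (s : 'I_n -> 'I_m) (L : 'M[int]_n) (q : 'rV[R]_n -> 'rV[R]_D).
Hypothesis L_inv : L *m colsub s lam = 1%:M.
Hypothesis q_cont : continuous q.
Hypothesis q_coord : forall p, P p -> q (\row_j l (s j) p) = p.
Hypothesis coord_q : forall t j, l (s j) (q t) = t 0 j.
Hypothesis P_q : forall t, (forall i, 0 <= l i (q t)) -> P (q t).

(* Off the open star of the vertex the chart is undefined; multiplying it by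
   the product of the remaining facet functions makes it global. *)
Definition cutoff (p : 'rV[R]_D) : R := \prod_(i | i \notin codom s) l i p.

(** The point of [P] is kept as a first component, so that equal values force equal points of [P],
    even when one argument is not known to lie over the open star. *)
Definition chart_map (x : TP) : E :=
  (set_val x.2, \matrix_(j, c)
    (cutoff (set_val x.2) * (l (s j) (set_val x.2) * thom L (set_val x.1) j c))).

Definition chart_coords (y : E) : 'rV[R]_(n * 2) := mxvec ((cutoff y.1)^-1 *: y.2).

Definition chart_inv (z : 'rV[R]_(n * 2)) : E :=
  let p := q (mxvec_radii z) in (p, cutoff p *: vec_mx z).

Definition chart_codom : set 'rV[R]_(n * 2) :=
  [set z | forall i, i \notin codom s -> 0 < l i (q (mxvec_radii z))].

Lemma cutoff_neq0 p : P p -> cutoff p != 0 <-> forall i, F i p -> i \in codom s.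
Proof.
move=> Pp; split=> [/prodf_neq0 c0 i Fi|H].
  by apply/negPn/negP => /c0/eqP; apply; apply/(l_eq0 _ Pp).
by apply/prodf_neq0 => i; apply: contraNN => /eqP li; apply: H; exact/(l_eq0 _ Pp).
Qed.

Lemma cutoff_continuous : continuous cutoff.
Proof.
by apply: continuous_big => //; exact: mul_continuous.
Qed.

Lemma chart_map_continuous : continuous chart_map.
Proof.
have c2 : continuous (fun x : TP => set_val x.2).
  move=> x; apply: (@continuous_comp _ _ _ snd (set_val : set_type P -> _)).
    exact: cvg_snd.
  exact: set_val_continuous.
have c1 : continuous (fun x : TP => thom L (set_val x.1)).
  move=> x; apply: (@continuous_comp _ _ _ fst (fun g : set_type (@torus R n) => thom L (set_val g))).
    exact: cvg_fst.
  exact: thom_continuous.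
pose G (x : TP) : 'M[R]_(n, 2) := \matrix_(j, c)
  (cutoff (set_val x.2) * (l (s j) (set_val x.2) * thom L (set_val x.1) j c)).
suff c3 : continuous G by move=> x; exact: cvg_pair (c2 x) (c3 x).
apply: continuous_mx => j c.
have -> : (fun x => G x j c) =
  (fun x => cutoff (set_val x.2) * (l (s j) (set_val x.2) * thom L (set_val x.1) j c)).
  by apply/funext => x'; rewrite mxE.
have c3 : continuous (fun x : TP => cutoff (set_val x.2)).
  by move=> x; exact: (@continuous_comp _ _ _ (fun x : TP => set_val x.2) cutoff x (c2 x)
    (@cutoff_continuous _)).
have c4 : continuous (fun x : TP => l (s j) (set_val x.2)).
  by move=> x; exact: (@continuous_comp _ _ _ (fun x : TP => set_val x.2) (l (s j)) x (c2 x)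
    (@l_cont _ _)).
have c5 : continuous (fun x : TP => thom L (set_val x.1) j c).
  by move=> x; exact: (@continuous_comp _ _ _ (fun x : TP => thom L (set_val x.1)) (fun g => g j c) x (c1 x)
    (@coord_continuous R n 2 j c _)).
by move=> x; exact: continuousM (c3 x) (continuousM (c4 x) (c5 x)).
Qed.

(** Where the cutoff is nonzero, all facets through [p] are among the [F (s j)], and [L] sends their
    columns to basis vectors. Moving [g] in the subtorus thus changes only those coordinates of
    [thom L g] whose factor [l (s j) p] is zero. *)
Lemma chart_map_rel x y : toric_rel F lam x y -> chart_map x = chart_map y.
Proof.
case: x y => [g p] [h p'] /asboolP[/= <-{p'} [c cF ch]].
congr pair; apply/matrixP => j k; rewrite [LHS]mxE [RHS]mxE /=; have Pp : P (set_val p) by exact: set_valP.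
have [->|c0] := eqVneq (cutoff (set_val p)) 0; first by rewrite !mul0r.
have [/(l_eq0 _ Pp)->|Fj] := pselect (F (s j) (set_val p)); first by rewrite !mul0r !mulr0.
have Tg : torus (set_val g) by exact: set_valP.
have Th : torus (set_val h) by exact: set_valP.
congr (_ * (_ * _)); rewrite -(tlogK Tg) -(tlogK Th) -texpN -texpD in ch.
move/esym/texpB_int: ch => [z hz].
have Lc : (map_mx intr L *m (map_mx intr lam *m c)) j 0 = 0.
  rewrite mulmxA -map_mxM mxE big1// => i _.
  have [Fi|Fi] := pselect (F i (set_val p)); last first.
    by rewrite cF ?mulr0// inE; apply/asboolP.
  have /codomP[j' ij'] := (cutoff_neq0 Pp).1 c0 i Fi; rewrite ij' in Fi *.
  have := L_inv; rewrite mulmx_colsub => /matrixP/(_ j j'); rewrite !mxE => ->.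
  by case: eqP Fi Fj => [-> //|_ _ _]; rewrite mul0r.
have : texp (map_mx intr L *m tlog (set_val h)) =
       texp (map_mx intr L *m tlog (set_val g) + map_mx intr L *m (map_mx intr lam *m c)) :> 'M[R]_(n, 2).
  apply/texpB_int; exists (L *m z); rewrite map_mxM -hz !mulmxDr !mulmxN.
  by rewrite opprD addrA; congr (_ - _); rewrite addrC.
by rewrite /thom => ->; apply: texp_coord; rewrite [RHS]mxE Lc addr0.
Qed.

(** Equal values give equal phases in every coordinate [j] with [p] outside [F (s j)]. There the two
    logarithms, transformed by [L], differ by integers, and the other coordinates belong to the
    subtorus. *)
Lemma chart_map_sep x y : cutoff (set_val x.2) != 0 -> chart_map x = chart_map y ->
  toric_rel F lam x y.
Proof.
case: x y => [g p] [h p'] /= c0 [/val_inj pp']; rewrite -{p'}pp' => /matrixP gh.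
have Pp : P (set_val p) by exact: set_valP.
have Tg : torus (set_val g) by exact: set_valP.
have Th : torus (set_val h) by exact: set_valP.
apply/asboolP; split=> //=; set u := tlog (set_val g); set v := tlog (set_val h).
have ex j : exists z : int, ~ F (s j) (set_val p) -> (map_mx intr L *m (v - u)) j 0 = z%:~R.
  have [Fj|Fj] := pselect (F (s j) (set_val p)); first by exists 0.
  suff /cos_eq1_int[z zE] : cos (2 * pi * (map_mx intr L *m (v - u)) j 0) = 1 by exists z.
  have E c : thom L (set_val g) j c = thom L (set_val h) j c.
    move: (gh j c); rewrite !mxE => /(mulfI c0)/mulfI; apply.
    by apply/eqP => /(l_eq0 _ Pp).
  have := E 0; have := E 1; rewrite mulmxBr !mxE /= mulrBr cosB -/u -/v => -> ->.
  by rewrite -!expr2 cos2Dsin2.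
(* The difference splits as [d + z], with [d] supported on the facets through [p] and [z]
   integral. *)
pose d := \col_j if `[< F (s j) (set_val p) >] then (map_mx intr L *m (v - u)) j 0 else 0.
pose z := \col_j if `[< F (s j) (set_val p) >] then 0 else projT1 (cid (ex j)).
have dz : map_mx intr L *m (v - u) - d = map_mx intr z.
  apply/colP => j; rewrite [LHS]mxE [X in _ + X]mxE [d j 0]mxE [RHS]mxE [z j 0]mxE.
  case: asboolP => Fj; first by rewrite subrr.
  by rewrite subr0; case: cid => /= z' ->.
(* The coordinates of [d] are placed at the facet indices [s j]; [lam] maps this vector to
   [colsub s lam *m d], and [colsub s lam] is also a right inverse of [L]. *)
exists (colsub s 1%:M *m d).
  move=> i; rewrite inE => Fi; rewrite mxE big1// => j _; rewrite !mxE.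
  case: eqP => [ij|_]; last by rewrite mul0r.
  by rewrite -ij (negbTE Fi) mulr0.
rewrite mulmxA mulmx_colsub mulmx1 -map_mxsub.
rewrite -(tlogK Tg) -(tlogK Th) -texpN -texpD -/u -/v addrC.
apply/esym/texpB_int; exists (colsub s lam *m z).
rewrite map_mxM -dz mulmxBr mulmxA -map_mxM (mulmx1C L_inv) map_mx1 mul1mx //.
Qed.

Definition toric_chart (x : M) : E := chart_map (repr x).

Lemma toric_chart_pi x : toric_chart (\pi_M x)%qT = chart_map x.
Proof. by apply: chart_map_rel; apply/toric_space_eqP; rewrite reprK. Qed.

Lemma toric_chart_continuous : continuous toric_chart.
Proof.
apply/quotient_continuous; have -> : toric_chart \o (\pi_M)%qT = chart_map.
  by apply/funext => x; exact: toric_chart_pi.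
exact: chart_map_continuous.
Qed.

Definition chart_dom : set M := toric_chart @^-1` [set y | cutoff y.1 != 0].

Lemma chart_dom_open : open chart_dom.
Proof.
apply: open_comp; first by move=> *; exact: toric_chart_continuous.
have -> : [set y : E | cutoff y.1 != 0] = (cutoff \o fst) @^-1` [set r | r != 0] by [].
apply: open_comp; last exact: open_neq.
by move=> y _; apply: continuous_comp; [exact: cvg_fst|exact: cutoff_continuous].
Qed.

Lemma q_radii_continuous : continuous (q \o @mxvec_radii R n).
Proof.
by move=> z; apply: continuous_comp; [exact: mxvec_radii_continuous|exact: q_cont].
Qed.

Lemma chart_inv_continuous : continuous chart_inv.
Proof.
have c1 : continuous (cutoff \o (q \o @mxvec_radii R n)).
  by move=> z; apply: continuous_comp; [exact: q_radii_continuous|exact: cutoff_continuous].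
have c2 z := @continuousZ _ _ _ _ (@vec_mx R n 2) z (c1 z) (@vec_mx_continuous _ _ _ z).
by move=> z; exact: cvg_pair (@q_radii_continuous z) (c2 z).
Qed.

Lemma chart_coords_continuous y : cutoff y.1 != 0 -> {for y, continuous chart_coords}.
Proof.
move=> y0; have c1 : {for y, continuous (cutoff \o fst : E -> R)}.
  by apply: continuous_comp; [exact: cvg_fst|exact: cutoff_continuous].
have c2 := @continuousV _ _ (cutoff \o fst) y y0 c1.
have snd_cont : {for y, continuous (snd : E -> 'M[R]_(n, 2))} by exact: cvg_snd.
have c3 := @continuousZ _ _ _ _ (snd : E -> 'M[R]_(n, 2)) y c2 snd_cont.
have := @continuous_comp _ _ _ (fun y : E => (cutoff y.1)^-1 *: y.2) (@mxvec R n 2) y c3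
  (@mxvec_continuous _ _ _ _).
exact.
Qed.

Lemma chart_codom_open : open chart_codom.
Proof.
rewrite openE => z Vz.
have : \forall w \near z, forall i, i \notin codom s -> 0 < l i (q (mxvec_radii w)).
  pose Q i w := i \notin codom s -> 0 < l i (q (mxvec_radii w)).
  have : forall i, \forall w \near z, Q i w; last by move=> HQ; exact: (@filter_forall _ _ Q (nbhs z) _ HQ).
  move=> i; have [ci|ci] := boolP (i \in codom s).
    by apply: filterE => w; rewrite /Q ci.
  have : {for z, continuous (fun w => l i (q (mxvec_radii w)))}.
    apply: (@continuous_comp _ _ _ (@mxvec_radii R n) (l i \o q)).
      exact: mxvec_radii_continuous.
    by apply: continuous_comp; [exact: q_cont|exact: l_cont].
  move=> /(_ [set r | 0 < r]) H; have : nbhs z ((fun w => l i (q (mxvec_radii w))) @^-1` [set r | 0 < r]).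
    by apply: H; apply: open_nbhs_nbhs; split; [exact: open_gt|exact: Vz].
  by apply: filterS => w lw _.
by [].
Qed.

Lemma chart_domP x : chart_dom x ->
  chart_codom (chart_coords (toric_chart x)) /\
  chart_inv (chart_coords (toric_chart x)) = toric_chart x.
Proof.
rewrite /chart_dom /toric_chart /=; case: (repr x) => g p /= c0.
have Pp : P (set_val p) by exact: set_valP.
have zE : chart_coords (chart_map (g, p)) =
    mxvec (\matrix_(j, c) ((\row_j l (s j) (set_val p)) 0 j * thom L (set_val g) j c)).
  by congr mxvec; apply/matrixP => j c; rewrite !mxE mulKf.
have rE : mxvec_radii (chart_coords (chart_map (g, p))) = \row_j l (s j) (set_val p).
  rewrite zE mxvec_radiiK//; first exact: torus_texp.
  by move=> j; rewrite mxE; exact: l_ge0.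
have qE : q (mxvec_radii (chart_coords (chart_map (g, p)))) = set_val p by rewrite rE q_coord.
split=> [i is_|].
  rewrite qE lt_def l_ge0// andbT.
  by apply: contraNN is_ => /eqP/(l_eq0 _ Pp); exact: (cutoff_neq0 Pp).1.
by rewrite /chart_inv /= qE /chart_coords mxvecK scalerA mulfV// scale1r.
Qed.

Lemma chart_codomP z : chart_codom z ->
  chart_coords (chart_inv z) = z /\
  exists2 x, chart_dom x & toric_chart x = chart_inv z.
Proof.
move=> Vz; set p := q (mxvec_radii z).
have Pp : P p.
  apply: P_q => i; have [/codomP[j ->]|ci] := boolP (i \in codom s).
    by rewrite coord_q mxvec_radii_ge0.
  by rewrite ltW// Vz.
have c0 : cutoff p != 0.
  by apply/prodf_neq0 => i /Vz; rewrite lt_def => /andP[].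
split; first by rewrite /chart_coords /= scalerA mulVf// scale1r vec_mxK.
have [g Tg zg] := polar_decomposition z.
(* Applying [colsub s lam], the inverse of [L], yields a torus element with [thom L h = g]. *)
pose h := texp (map_mx intr (colsub s lam) *m tlog g) : 'M[R]_(n, 2).
pose x : TP := (exist _ h (mem_set (torus_texp _)), exist _ p (mem_set Pp)).
have xh : set_val x.1 = h by rewrite set_valE.
have xp : set_val x.2 = p by rewrite set_valE.
have xz : chart_map x = chart_inv z.
  rewrite /chart_map /chart_inv xh xp -/p; congr pair.
  apply/matrixP => j c; rewrite [LHS]mxE [RHS]mxE; congr (_ * _).
  rewrite coord_q {2}zg mxvecK [RHS]mxE thom_texp mulmxA -map_mxM L_inv map_mx1 mul1mx.
  by rewrite tlogK.
exists (\pi_M x)%qT; last by rewrite toric_chart_pi.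
change (cutoff (toric_chart (\pi_M x)%qT).1 != 0).
by rewrite toric_chart_pi xz.
Qed.

End Chart.

Lemma toric_space_manifold (I : finType) (s : I -> 'I_n -> 'I_m) (L : I -> 'M[int]_n)
    (q : I -> 'rV[R]_n -> 'rV[R]_D) :
  (forall i, L i *m colsub (s i) lam = 1%:M) ->
  (forall i, continuous (q i)) ->
  (forall i p, P p -> q i (\row_j l (s i j) p) = p) ->
  (forall i t j, l (s i j) (q i t) = t 0 j) ->
  (forall i t, (forall k, 0 <= l k (q i t)) -> P (q i t)) ->
  (forall p, P p -> exists i, forall k, F k p -> k \in codom (s i)) ->
  manifold R (n * 2) M.
Proof.
move=> L_inv q_cont q_coord coord_q P_q cover.
apply: (@compact_charts_manifold R (n * 2) M E I (fun i => toric_chart (s i) (L i))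
  (fun i => chart_coords (s i)) (fun i => chart_inv (s i) (q i))
  (fun i => chart_dom (s i) (L i)) (fun i => chart_codom (s i) (q i))).
- exact: toric_space_compact.
- exact: norm_hausdorff.
- by move=> i; exact: toric_chart_continuous.
- by move=> i x; exact: chart_coords_continuous.
- by move=> i; exact: chart_inv_continuous.
- by move=> i; exact: chart_dom_open.
- by move=> i; exact: chart_codom_open.
- by move=> i x; exact: (chart_domP (q_coord i)).
- by move=> i z; exact: (chart_codomP (L_inv i) (coord_q i) (@P_q i)).
- move=> i x y xU xy; rewrite -[x]reprK -[y]reprK; apply/toric_space_eqP.
  exact: (chart_map_sep (L_inv i)).
- move=> x; have [i ix] := cover _ (@set_valP _ _ (repr x).2); exists i.
  by apply/(cutoff_neq0 _ (@set_valP _ _ (repr x).2)).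
Qed.

End ToricCharts.

(** * Simple polytopes *)

Section AffineForms.
Variables (R : realType) (D : nat).
Implicit Types (f : 'rV[R]_D -> R) (x y z : 'rV[R]_D).

Definition affine_form f := exists (a : 'cV[R]_D) (b : R), forall x, f x = (x *m a) 0 0 + b.

Lemma affine_formE f x y z t : affine_form f ->
  f (x + t *: (y - z)) = f x + t * (f y - f z).
Proof.
move=> [a [b fE]]; rewrite !fE mulmxDl -scalemxAl mulmxBl !mxE.
by ring.
Qed.

Lemma affine_form_col k (A : 'M[R]_(D, k)) (b : 'rV[R]_k) i :
  affine_form (fun x => (x *m A + b) 0 i).
Proof.
exists (col i A), (b 0 i) => x; rewrite !mxE; congr (_ + _).
by apply: eq_bigr => j _; rewrite !mxE.
Qed.

Lemma affine_form_frame f n (B : 'M[R]_(n, D)) x (y : 'rV[R]_n) : affine_form f ->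
  f (x + y *m B) = f x + \sum_i y 0 i * (f (x + row i B) - f x).
Proof.
move=> [a [b fE]].
have fB (u : 'rV[R]_D) : f (x + u) - f x = (u *m a) 0 0.
  by rewrite !fE mulmxDl mxE; ring.
rewrite -(subrK (f x) (f (x + _))) addrC fB -mulmxA mxE; congr (_ + _).
by apply: eq_bigr => i _; rewrite fB -row_mul [in RHS]mxE.
Qed.

Lemma segment_zero f x y : affine_form f -> 0 < f x -> f y < 0 ->
  exists t, [/\ 0 < t, t < 1 & f (x + t *: (y - x)) = 0].
Proof.
move=> fa fx fy; have d : 0 < f x - f y by lra.
exists (f x / (f x - f y)); rewrite divr_gt0// ltr_pdivrMr// mul1r affine_formE//.
split=> //; first lra.
rewrite -[f y - f x]opprB mulrN divfK ?subrr// gt_eqF//.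
Qed.

Lemma small_step (I : finType) (c s : I -> R) : (forall i, 0 < c i) ->
  exists2 e, 0 < e & forall i, 0 < c i + e * s i.
Proof.
move=> c0; pose d i := c i / (`|s i| + 1).
have d0 i : 0 < d i by rewrite divr_gt0// ltr_wpDl.
have e0 : 0 < \big[Num.min/1]_i d i by apply/bigmin_gtP; split.
exists (\big[Num.min/1]_i d i) => // i.
have ed : \big[Num.min/1]_i d i <= d i by exact: bigmin_le.
have cE : c i = d i * (`|s i| + 1) by rewrite divfK// gt_eqF// ltr_wpDl.
have := d0 i; have : - `|s i| <= s i by rewrite lerNl -normrN ler_norm.
have := normr_ge0 (s i); rewrite cE; move: ed e0.
set e := \big[_/_]_ _ _; move: (d i) (s i) `|s i| => x y z *; nra.
Qed.

End AffineForms.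

(** * A polytope is cut out of its affine hull by its facet inequalities *)

Section Halfspaces.
Variables (R : realType) (n m D : nat) (P : set 'rV[R]_D) (F : 'I_m -> set 'rV[R]_D).
Variables (x0 : 'rV[R]_D) (B : 'M[R]_(n, D)).
Hypothesis B_free : row_free B.
Hypothesis Px0 : P x0.
Hypothesis PxB : forall i, P (x0 + row i B).
Hypothesis P_sub : forall x, P x -> (x - x0 <= B)%MS.

Local Notation in_hull x := (x - x0 <= B)%MS.

Lemma in_hullD x y z t : in_hull x -> in_hull y -> in_hull z ->
  in_hull (x + t *: (y - z)).
Proof.
move=> hx hy hz; rewrite addrAC addmx_sub// scalemx_sub//.
by rewrite -(subrKA x0) addmx_sub// -opprB -scaleN1r scalemx_sub.
Qed.

(** The barycenter of the simplex on the [n + 1] points [x0] and [x0 + row i B]; by the next lemmas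
    it serves as a point of the relative interior. *)
Definition barycenter := x0 + const_mx n.+1%:R^-1 *m B.

Lemma in_hull_barycenter : in_hull barycenter.
Proof. by rewrite /barycenter addrC addKr submxMl. Qed.

(** The value at the barycenter is the mean of nonnegative values at the points of the affine frame.
    If it were zero, [f] would vanish on the frame and hence on the whole hull. *)
Lemma barycenter_gt0 f x : affine_form f -> (forall p, P p -> 0 <= f p) ->
  in_hull x -> f x != 0 -> 0 < f barycenter.
Proof.
move=> fa f_ge0 hx fx.
have c0 : (0 : R) < n.+1%:R^-1 by rewrite invr_gt0.
have nE : n.+1%:R^-1 * n%:R = 1 - n.+1%:R^-1 :> R.
  by rewrite -[n%:R](addrK 1) -natr1 mulrBr mulVf// mulr1.
have bE : f barycenter = n.+1%:R^-1 * (f x0 + \sum_i f (x0 + row i B)).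
  rewrite /barycenter affine_form_frame//.
  under eq_bigr do rewrite mxE.
  rewrite -mulr_sumr sumrB sumr_const card_ord -[f x0 *+ n]mulr_natl mulrBr mulrA nE; ring.
rewrite bE pmulr_rgt0// lt_def addr_ge0 ?f_ge0// ?andbT; last by apply: sumr_ge0 => i _; exact: f_ge0.
apply: contraNN fx.
rewrite paddr_eq0 ?f_ge0//; last by apply: sumr_ge0 => i _; exact: f_ge0.
move=> /andP[/eqP f0]; rewrite psumr_eq0 => [/allP fB|i _]; last exact: f_ge0.
have /submxP[y yB] := hx; rewrite -(subrK x0 x) addrC yB affine_form_frame// f0 add0r big1// => i _.
by have /eqP -> := fB i (mem_index_enum _); rewrite subr0 mulr0.
Qed.

Lemma face_affine_zero f : affine_form f -> (forall p, P p -> 0 <= f p) ->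
  face P (P `&` [set x | f x = 0]).
Proof.
move=> [a [b fE]] f_ge0; exists a, b; split=> [x Px|].
  by rewrite -fE f_ge0.
by apply/seteqP; split=> x /= [Px]; [rewrite fE|rewrite -fE].
Qed.

(* The dimension is witnessed near [w]: any small step from [w] in the
   hyperplane [f = 0] of the affine hull stays in [P]. *)
Lemma facet_affine_zero f w : affine_form f -> (forall p, P p -> 0 <= f p) ->
  P w -> f w = 0 -> 0 < f barycenter ->
  (forall k (C : 'M[R]_(k, D)), (C <= B)%MS -> (forall i, f (w + row i C) = 0) ->
    exists2 e, 0 < e & forall i, P (w + e *: row i C)) ->
  facet P n (P `&` [set x | f x = 0]).
Proof.
move=> fa f_ge0 Pw fw fb near_w; split; first exact: face_affine_zero.
have [a [b fE]] := fa.
have fD x u : f (x + u) = f x + (u *m a) 0 0 by rewrite !fE mulmxDl mxE; ring.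
(* [f] is zero at [w] and positive at the barycenter, hence not constant on the hull, so the
   directions along which it is constant have dimension [n - 1]. *)
have a_neq0 : B *m a != 0.
  apply: contraTneq fb => Ba.
  have -> : barycenter = w + (barycenter - w) by rewrite addrC subrK.
  have /submxP[y ->] : (barycenter - w <= B)%MS.
    by rewrite -(subrKA x0) addmx_sub ?in_hull_barycenter// -opprB -scaleN1r scalemx_sub// P_sub.
  by rewrite fD fw -mulmxA Ba mulmx0 mxE add0r ltxx.
pose K := row_base (kermx (B *m a)).
have K_ker : K *m (B *m a) = 0.
  by apply: sub_kermxP; rewrite eq_row_base.
exists (\rank (kermx (B *m a))); split; last first.
  rewrite mxrank_ker.
  have -> : \rank (B *m a) = 1%N.
    by apply/eqP; rewrite eqn_leq rank_leq_col lt0n mxrank_eq0.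
  rewrite subnK//; case: n B a_neq0 {near_w K K_ker} => // B'.
  by rewrite [_ *m _]flatmx0 eqxx.
have KBf i : f (w + row i (K *m B)) = 0.
  by rewrite fD fw -row_mul -mulmxA K_ker row0 mxE add0r.
have [e e0 ePw] := near_w _ _ (submxMl K B) KBf.
exists w, (e *: (K *m B)); split=> //.
- by rewrite /row_free (mxrank_scale_nz _ (lt0r_neq0 e0)) mxrankMfree// eq_row_base.
- move=> i; split=> /=; first by rewrite linearZ; exact: ePw.
  rewrite fD fw linearZ /= -scalemxAl -row_mul -mulmxA K_ker row0 scaler0 mxE add0r //.
- move=> x [Px /= fx].
  have /submxP[y yB] : (x - w <= B)%MS.
    by rewrite -(subrKA x0) addmx_sub ?P_sub// -opprB -scaleN1r scalemx_sub// P_sub.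
  have : (y <= kermx (B *m a))%MS.
    apply/sub_kermxP/rowP => j; rewrite ord1 mulmxA -yB [RHS]mxE.
    by have := fD w (x - w); rewrite addrC subrK fx fw add0r.
  rewrite -(eq_row_base (kermx _)) => /submxP[z yz].
  rewrite yB yz -mulmxA -[X in (X <= _)%MS]scale1r -(mulVf (lt0r_neq0 e0)) -scalerA scalemxAr.
  by rewrite scalemx_sub// submxMl.
Qed.

Lemma polytope_barycenter : polytope P -> P barycenter.
Proof.
move=> [_ [k [A [b PE]]]]; rewrite PE => i /=.
have [->//|c0] := eqVneq ((barycenter *m A + b) 0 i) 0.
apply/ltW/(barycenter_gt0 (affine_form_col A b i) _ in_hull_barycenter c0).
by rewrite PE => p; exact.
Qed.

(* An irredundant subsystem [S] of the inequalities defining [P] in its affine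
   hull has only facet inequalities. For [j \in S], the segment from the
   barycenter to a point violating only [c j] crosses [c j = 0] at a point [w]
   where the other inequalities of [S] are strict. *)
Lemma facet_halfspaces (l : 'I_m -> 'rV[R]_D -> R) x :
  polytope P -> (forall G, facet P n G -> exists i, G = F i) ->
  (forall i, affine_form (l i)) -> (forall i p, P p -> 0 <= l i p) ->
  (forall i, F i = P `&` [set p | l i p = 0]) ->
  in_hull x -> (forall i, 0 <= l i x) -> P x.
Proof.
move=> polyP F_all la l_ge0 FE hx lx.
have Pb := polytope_barycenter polyP.
have hb := in_hull_barycenter.
have [_ [k [A [b PE]]]] := polyP.
pose c j (p : 'rV[R]_D) := (p *m A + b) 0 j.
have ca j : affine_form (c j) := affine_form_col A b j.
have c_ge0 j p : P p -> 0 <= c j p by rewrite PE => /(_ j).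
pose suff (S : {set 'I_k}) := `[< forall p, in_hull p -> (forall j, j \in S -> 0 <= c j p) -> P p >].
have [|S /minsetP[/asboolP S_suff S_min] _] := @minset_exists _ suff [set: 'I_k].
  by apply/asboolP => p _ cp; rewrite PE => j; apply: cp; rewrite inE.
have irredundant j : j \in S -> exists y,
    [/\ in_hull y, forall i, i \in S -> i != j -> 0 <= c i y & c j y < 0].
  move=> jS; have : ~ forall p, in_hull p -> (forall i, i \in (S :\ j)%SET -> 0 <= c i p) -> P p.
    by move=> /asboolP/S_min/(_ (subD1set _ _))/setP/(_ j); rewrite !inE eqxx jS.
  move=> /existsNP[y /not_implyP[hy /not_implyP[cy nPy]]].
  have cy' i : i \in S -> i != j -> 0 <= c i y by move=> iS ij; apply: cy; rewrite !inE ij.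
  exists y; split=> //; rewrite ltNge; apply/negP => cjy; apply: nPy; apply: S_suff => // i iS.
  by have [->//|ij] := eqVneq i j; exact: cy'.
have cb j : j \in S -> 0 < c j barycenter.
  move=> /irredundant[y [hy _ cy]].
  by apply: (barycenter_gt0 (ca j) (c_ge0 j) hy); rewrite lt_eqF.
apply: (S_suff) => // j jS; rewrite leNgt; apply/negP => cx.
have [y [hy ySj cy]] := irredundant j jS.
have [t [t0 t1 ct]] := segment_zero (ca j) (cb j jS) cy.
set w := barycenter + t *: (y - barycenter) in ct.
have hw : in_hull w by exact: in_hullD.
have cw i : i \in S -> i != j -> 0 < c i w.
  move=> iS ij; have ciy := ySj i iS ij; rewrite /w affine_formE//.
  by have := cb i iS; nra.
have Pw : P w.
  by apply: S_suff => // i iS; have [->|ij] := eqVneq i j; [rewrite ct|exact/ltW/cw].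
have near_w k' (C : 'M[R]_(k', D)) : (C <= B)%MS -> (forall i, c j (w + row i C) = 0) ->
    exists2 e, 0 < e & forall i, P (w + e *: row i C).
  (* [small_step] runs over a whole finite type; pairs without a strict inequality to preserve
     receive the harmless value 1. *)
  move=> CB cC; pose cc (ia : 'I_k' * 'I_k) := if (ia.2 \in S) && (ia.2 != j) then c ia.2 w else 1.
  have [|e e0 eP] := @small_step R _ cc (fun ia => c ia.2 (w + row ia.1 C) - c ia.2 w).
    by case=> i a; rewrite /cc /=; case: ifP => // /andP[aS aj]; exact: cw.
  exists e => // i; apply: S_suff => [|a aS].
    by rewrite addrAC addmx_sub// scalemx_sub// (submx_trans _ CB)// row_sub.
  have -> : w + e *: row i C = w + e *: (w + row i C - w).
    by rewrite [w + row i C]addrC addrK.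
  rewrite affine_formE//; have [->|aj] := eqVneq a j; first by rewrite ct cC subrr mulr0 addr0.
  by have := eP (i, a); rewrite /cc /= aS aj => /ltW.
have [i FiE] := F_all _ (facet_affine_zero (ca j) (c_ge0 j) Pw ct (cb j jS) near_w).
have lw : l i w = 0.
  have : F i w by rewrite -FiE.
  by rewrite FE => -[].
have lb : 0 < l i barycenter.
  rewrite lt_def l_ge0// andbT; apply/eqP => lb.
  have : F i barycenter by rewrite FE.
  by rewrite -FiE => -[_ /= cb0]; have := cb j jS; rewrite cb0 ltxx.
(* The segment towards [x] crosses [c j = 0] at a point [v] with [l i v > 0]. Continuing the line
   from [v] through [w] slightly beyond [w] stays in [P], because [c j] is zero along it and the
   other inequalities are strict at [w]; yet [l i], zero at [w], becomes negative there. *)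
have [r [r0 r1 cr]] := segment_zero (ca j) (cb j jS) cx.
set v := barycenter + r *: (x - barycenter) in cr.
have hv : in_hull v by exact: in_hullD.
have lv : 0 < l i v by rewrite /v affine_formE//; have := lx i; nra.
pose cc a := if (a \in S) && (a != j) then c a w else 1.
have [|e e0 eP] := @small_step R _ cc (fun a => c a w - c a v).
  by move=> a; rewrite /cc; case: ifP => // /andP[aS aj]; exact: cw.
have Pe : P (w + e *: (w - v)).
  apply: S_suff => [|a aS]; first exact: in_hullD.
  rewrite affine_formE//; have [->|aj] := eqVneq a j; first by rewrite ct cr subrr mulr0 addr0.
  by have := eP a; rewrite /cc aS aj => /ltW.
by have := l_ge0 i _ Pe; rewrite affine_formE// lw; nra.
Qed.

End Halfspaces.

Lemma mulmxr_continuous (R : realType) m n p (A : 'M[R]_(n, p)) :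
  continuous (fun x : 'M[R]_(m, n) => x *m A).
Proof.
apply: continuous_mx => i j.
have -> : (fun x : 'M[R]_(m, n) => (x *m A) i j) = (fun x => \sum_k x i k * A k j).
  by apply/funext => x; rewrite mxE.
by apply: continuous_sum => k x; apply: continuousM; [exact: coord_continuous|exact: cst_continuous].
Qed.

Lemma affine_mx_continuous (R : realType) m n p (A : 'M[R]_(n, p)) (b : 'M[R]_(m, p)) :
  continuous (fun x : 'M[R]_(m, n) => x *m A + b).
Proof. by move=> x; exact: cvgD (@mulmxr_continuous _ _ _ _ _ x) (cvg_cst _). Qed.

Lemma affine_coord_continuous (R : realType) n p (A : 'M[R]_(n, p)) (b : 'rV[R]_p) i :
  continuous (fun x : 'rV[R]_n => (x *m A + b) 0 i).
Proof.
move=> x; apply: (@continuous_comp _ _ _ (fun x : 'rV[R]_n => x *m A + b) (fun y => y 0 i)).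
  exact: affine_mx_continuous.
exact: coord_continuous.
Qed.

Lemma polytope_compact (R : realType) D (P : set 'rV[R]_D) : polytope P -> compact P.
Proof.
move=> [bP [k [A [b PE]]]]; apply: bounded_closed_compact => //.
have -> : P = \bigcap_i [set x | 0 <= (x *m A + b) 0 i].
  by rewrite PE; apply/seteqP; split=> x /= H i; [move=> _|]; exact: H.
apply: closed_bigI => i _.
have /continuous_closedP := @affine_coord_continuous _ _ _ A b i.
by move=> /(_ [set r : R | 0 <= r]); apply; exact: closed_ge.
Qed.

(** * Vertices and the affine coordinates they carry *)

Section Vertices.
Variables (R : realType) (n m D : nat) (P : set 'rV[R]_D) (F : 'I_m -> set 'rV[R]_D).
Variables (x0 : 'rV[R]_D) (B : 'M[R]_(n, D)) (A : 'M[R]_(D, m)) (b : 'rV[R]_m).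
Hypothesis B_free : row_free B.
Hypothesis P_hull : forall x, P x -> (x - x0 <= B)%MS.
Hypothesis P_bounded : bounded_set P.

Definition facet_form i (x : 'rV[R]_D) := (x *m A + b) 0 i.
Local Notation l := facet_form.

Hypothesis l_ge0 : forall i p, P p -> 0 <= l i p.
Hypothesis FE : forall i, F i = P `&` [set p | l i p = 0].
Hypothesis P_halfspaces : forall x, (x - x0 <= B)%MS -> (forall i, 0 <= l i x) -> P x.

Lemma facet_form_dir i x (u : 'rV[R]_n) : l i (x + u *m B) = l i x + (u *m (B *m A)) 0 i.
Proof. by rewrite /facet_form mulmxDl addrAC mulmxA [in LHS]mxE. Qed.

Lemma facet_form_eq0 i p : P p -> F i p <-> l i p = 0.
Proof. by move=> Pp; rewrite FE; split=> [[]|]. Qed.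

(* No line of the affine hull through [v] stays in all the facets at [v]. *)
Definition rigid v := forall u : 'rV[R]_n,
  (forall i, F i v -> (u *m (B *m A)) 0 i = 0) -> u = 0.

Lemma hullD x (u : 'rV[R]_n) : P x -> (x + u *m B - x0 <= B)%MS.
Proof. by move=> Px; rewrite addrAC addmx_sub ?P_hull// submxMl. Qed.

(** Otherwise no facet form would decrease along [u], and [P] would contain an unbounded ray. *)
Lemma leave_polytope p (u : 'rV[R]_n) : P p -> u != 0 ->
  exists i, (u *m (B *m A)) 0 i < 0.
Proof.
move=> Pp u0; apply: contrapT => /forallNP nneg.
have s_ge0 i : 0 <= (u *m (B *m A)) 0 i by rewrite leNgt; apply/negP; exact: nneg.
have ray t : 0 <= t -> P (p + (t *: u) *m B).
  move=> t0; apply: P_halfspaces => [|i]; first exact: hullD.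
  by rewrite facet_form_dir -scalemxAl mxE addr_ge0 ?l_ge0// mulr_ge0.
have uB0 : 0 < `|u *m B|.
  by rewrite normr_gt0; apply: contraNneq u0 => uB; apply/eqP/(row_free_inj B_free); rewrite mul0mx.
have [M [_ PM]] := P_bounded.
pose N := `|M| + 1; have MN : M < N by rewrite ltr_pwDr// ler_norm.
have N0 : 0 <= N by rewrite addr_ge0.
(* The displacement has norm [N + |p| + 1], so the end point has norm at least [N + 1], beyond the
   bound [N]. *)
pose t := (N + `|p| + 1) / `|u *m B|.
have t0 : 0 <= t by rewrite divr_ge0// !addr_ge0.
have /= := PM N MN _ (ray t t0); apply/negP; rewrite -ltNge.
have : `|(t *: u) *m B| = N + `|p| + 1.
  by rewrite -scalemxAl normrZ ger0_norm// divfK// gt_eqF.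
have := lerB_normD ((t *: u) *m B) p; rewrite [_ + p]addrC => H E.
by apply: lt_le_trans H; rewrite E; lra.
Qed.

(** From [p] one moves along a direction tangent to all its facets until the first other facet form
    reaches zero: the index minimizing [l i p / - s i] among negative slopes. *)
Lemma more_facets p : P p -> ~ rigid p -> exists p',
  [/\ P p', forall i, F i p -> F i p' & exists2 i, F i p' & ~ F i p].
Proof.
move=> Pp /existsNP[u /not_implyP[uF /eqP u0]].
have [i0 si0] := leave_polytope Pp u0.
pose s i := (u *m (B *m A)) 0 i.
have [i si i_min] := @arg_minP _ R 'I_m i0 (fun i => s i < 0) (fun i => l i p / - s i) si0.
set t := l i p / - s i in i_min.
have t0 : 0 <= t by rewrite divr_ge0 ?l_ge0// oppr_ge0 ltW.
have lE k : l k (p + (t *: u) *m B) = l k p + t * s k.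
  by rewrite facet_form_dir -scalemxAl mxE.
have Pp' : P (p + (t *: u) *m B).
  apply: P_halfspaces => [|k]; first exact: hullD.
  rewrite lE; have [sk|sk] := leP 0 (s k); first by rewrite addr_ge0 ?l_ge0// mulr_ge0.
  have := i_min k sk; rewrite ler_pdivlMr ?oppr_gt0// mulrN => H; lra.
exists (p + (t *: u) *m B); split=> // [k Fk|].
  apply/(facet_form_eq0 _ Pp'); rewrite lE (facet_form_eq0 _ Pp).1// add0r.
  by rewrite /s uF// mulr0.
exists i; first by apply/(facet_form_eq0 _ Pp'); rewrite lE /t invrN mulrN mulNr divfK ?lt_eqF// subrr.
by move=> /uF si'; move: si; rewrite /s si' ltxx.
Qed.

Lemma exists_rigid p : P p -> exists v, [/\ P v, forall i, F i p -> F i v & rigid v].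
Proof.
have [k] := ubnP (m - #|facets_at F p|); elim: k p => // k IH p pk Pp.
have [rp|nrp] := pselect (rigid p); first by exists p.
have [p' [Pp' pp' [i Fi nFi]]] := more_facets Pp nrp.
have [|//|v [Pv p'v rv]] := IH p'; last by exists v; split=> // j Fj; apply: p'v; exact: pp'.
have lt : (#|facets_at F p| < #|facets_at F p'|)%N.
  apply: proper_card; apply/properP; split.
    by apply/fintype.subsetP => j; rewrite inE => /asboolP Fj; rewrite inE; apply/asboolP; exact: pp'.
  by exists i; rewrite inE; [exact/asboolP|apply/negP => /asboolP].
have := max_card (mem (facets_at F p')); rewrite card_ord => le.
by rewrite -ltnS (leq_trans _ pk)// ltnS ltn_sub2l// (leq_trans lt).
Qed.

Lemma rigid_eq v x : P v -> P x -> rigid v -> (forall i, F i v -> F i x) -> x = v.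
Proof.
move=> Pv Px rv vx.
have /submxP[u xvu] : (x - v <= B)%MS.
  by rewrite -(subrKA x0) addmx_sub ?P_hull// -opprB -scaleN1r scalemx_sub// P_hull.
have u0 : u = 0.
  apply: rv => i Fi; have := facet_form_dir i v u; rewrite -xvu [v + _]addrC subrK.
  rewrite (facet_form_eq0 _ Px).1; last exact: vx.
  by rewrite (facet_form_eq0 _ Pv).1// add0r.
by apply/eqP; rewrite -subr_eq0 xvu u0 mul0mx.
Qed.

(** The sum of the forms of the facets at [v] is nonnegative on [P] and vanishes only on their
    common intersection, which rigidity reduces to [v]. *)
Lemma rigid_vertex v : P v -> rigid v -> vertex P v.
Proof.
move=> Pv rv; pose h x := \sum_(i in facets_at F v) l i x.
have [a [c hE]] : affine_form h.
  exists (\sum_(i in facets_at F v) col i A), (\sum_(i in facets_at F v) b 0 i) => x.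
  rewrite mulmx_sumr summxE -big_split; apply: eq_bigr => i _.
  by rewrite /facet_form !mxE; congr (_ + _); apply: eq_bigr => j _; rewrite !mxE.
have h_ge0 x : P x -> 0 <= h x by move=> Px; apply: sumr_ge0 => i _; exact: l_ge0.
exists a, c; split=> [x Px|]; first by rewrite -hE h_ge0.
apply/seteqP; split=> [_ ->|x [Px /=]].
  split=> //=; rewrite -hE; apply: big1 => i; rewrite inE => /asboolP Fi.
  exact/(facet_form_eq0 _ Pv).
rewrite -hE => hx; apply: rigid_eq => // i Fi; apply/(facet_form_eq0 _ Px).
have /eqP := hx; rewrite psumr_eq0 => [/allP/(_ i (mem_index_enum _))|j _]; last exact: l_ge0.
by rewrite inE => /implyP; rewrite (asboolT Fi) => /(_ isT)/eqP.
Qed.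

Lemma rigid_codim_face v : P v -> rigid v ->
  codim_face P n n (facets_meet P F (facets_at F v)).
Proof.
move=> Pv rv; have -> : facets_meet P F (facets_at F v) = [set v].
  apply/seteqP; split=> [x [Px /= xF]|_ ->].
    by apply: rigid_eq => // i Fi; apply: xF; rewrite inE; exact/asboolP.
  by split=> //= i; rewrite inE => /asboolP.
split; first exact: rigid_vertex.
(* A point is zero-dimensional, its frame being the matrix with no rows. *)
exists 0%N; split=> //; exists v, 0; split=> //.
- by rewrite /row_free mxrank0.
- by case.
- by move=> x ->; rewrite subrr sub0mx.
Qed.

Definition vertex_mx (s : 'I_n -> 'I_m) : 'M[R]_n := colsub s (B *m A).

Definition vertex_coords_inv (s : 'I_n -> 'I_m) (t : 'rV[R]_n) : 'rV[R]_D :=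
  x0 + (t - \row_j l (s j) x0) *m invmx (vertex_mx s) *m B.

(** A kernel row is a direction on which every facet form at [v] has slope zero, and rigidity makes
    it vanish. *)
Lemma rigid_unitmx v (s : 'I_n -> 'I_m) : rigid v -> (forall i, F i v -> i \in codom s) ->
  vertex_mx s \in unitmx.
Proof.
move=> rv vs; rewrite -row_free_unit -kermx_eq0; apply/eqP/row_matrixP => i.
rewrite row0; apply: rv => k /vs/codomP[j ->].
have : row i (kermx (vertex_mx s)) *m vertex_mx s = 0.
  by apply/sub_kermxP; exact: row_sub.
by rewrite mulmx_colsub => /rowP/(_ j); rewrite !mxE.
Qed.

Section Coords.
Variable (s : 'I_n -> 'I_m).
Hypothesis s_unit : vertex_mx s \in unitmx.

Lemma vertex_coords_inv_continuous : continuous (vertex_coords_inv s).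
Proof.
have -> : vertex_coords_inv s = (fun t => t *m (invmx (vertex_mx s) *m B) +
    (x0 - (\row_j l (s j) x0) *m (invmx (vertex_mx s) *m B))).
  by apply/funext => t; rewrite /vertex_coords_inv -mulmxA mulmxBl addrCA.
exact: affine_mx_continuous.
Qed.

Lemma facet_form_row (y : 'rV[R]_n) :
  (\row_j l (s j) (x0 + y *m B)) = (\row_j l (s j) x0) + y *m vertex_mx s.
Proof. by apply/rowP => j; rewrite mulmx_colsub [LHS]mxE facet_form_dir !mxE. Qed.

Lemma vertex_coordsK p : P p -> vertex_coords_inv s (\row_j l (s j) p) = p.
Proof.
move=> /P_hull/submxP[y py]; have -> : p = x0 + y *m B by rewrite -py addrC subrK.
by rewrite /vertex_coords_inv facet_form_row [_ + y *m _]addrC addrK mulmxK.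
Qed.

Lemma vertex_coords_invK t j : l (s j) (vertex_coords_inv s t) = t 0 j.
Proof.
have := facet_form_row ((t - \row_j l (s j) x0) *m invmx (vertex_mx s)).
rewrite -/(vertex_coords_inv s t) mulmxKV// [_ + (t - _)]addrC subrK => /rowP/(_ j).
by rewrite mxE.
Qed.

Lemma vertex_coords_inv_hull t : (vertex_coords_inv s t - x0 <= B)%MS.
Proof. by rewrite /vertex_coords_inv addrC addKr submxMl. Qed.

End Coords.

End Vertices.

(** * Direct summands of lattices *)

Lemma subgroup_sum (V : zmodType) (S : set V) (I : Type) (r : seq I) (f : I -> V) :
  subgroup S -> (forall i, S (f i)) -> S (\sum_(i <- r) f i).
Proof.
move=> [S0 SB] Sf; elim/big_ind: _ => // x y Sx Sy.
by rewrite -[y]opprK -[- y]sub0r; apply: (SB) => //; exact: SB.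
Qed.

Lemma subgroup_scalez n (S : set 'cV[int]_n) (a : int) v :
  subgroup S -> S v -> S (a *: v).
Proof.
move=> Ssub Sv; have [S0 SB] := Ssub; have nat k : S (k%:Z *: v).
  by rewrite -natz scaler_nat -[k]card_ord -sumr_const; exact: subgroup_sum.
case: a => k; first exact: nat.
by rewrite NegzE scaleNr -sub0r; exact: SB.
Qed.

(** Full rank makes [A] injective, so projecting along a complement [C] and reading off the
    coordinates defines [L]. Conversely, the kernel of a left inverse is a complement. *)
Lemma left_inverse_summand n l (A : 'M[int]_(n, l)) :
  spans_summand_of_rank l A <-> exists L : 'M[int]_(l, n), L *m A = 1%:M.
Proof.
pose Q : 'M[rat]_(n, l) := map_mx intr A.
split=> [[[_ [C [C_sub C0 C_span]]] rk]|[L LA]].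
  have A_inj (c : 'cV[int]_l) : A *m c = 0 -> c = 0.
    move=> Ac; apply/matrixP => i j; apply: (@intr_inj rat).
    suff : (map_mx intr c : 'cV[rat]_l)^T = 0 by move=> /matrixP/(_ j i); rewrite !mxE.
    have Qf : row_free Q^T by rewrite /row_free mxrank_tr rk.
    apply: (row_free_inj Qf); rewrite mul0mx -trmx_mul -map_mxM Ac.
    by apply/matrixP => i' j'; rewrite !mxE.
  have ex k : exists c : 'cV[int]_l, C (delta_mx k 0 - A *m c).
    by have [_ [z [[c _ <-] Cz ->]]] := C_span (delta_mx k 0); exists c; rewrite addrC addKr.
  pose L : 'M[int]_(l, n) := \matrix_(i, k) projT1 (cid (ex k)) i 0.
  have LC x : C (x - A *m (L *m x)).
    have -> : x - A *m (L *m x) = \sum_k x k 0 *: (delta_mx k 0 - A *m projT1 (cid (ex k))).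
      under eq_bigr do rewrite scalerBr scalemxAr.
      rewrite sumrB -mulmx_sumr; congr (_ - A *m _).
        by rewrite {1}[x]matrix_sum_delta; apply: eq_bigr => k _; rewrite big_ord1.
      apply/colP => i; rewrite summxE mxE; apply: eq_bigr => k _.
      by rewrite !mxE mulrC.
    apply: subgroup_sum => // k; apply: subgroup_scalez => //.
    by case: cid.
  exists L; apply/matrixP => i j; pose c : 'cV[int]_l := delta_mx j 0.
  (* This vector lies in the span and, by [LC], in the complement; hence it is zero, and injectivity
     of [A] gives [L *m A *m c = c]. *)
  have : (zspan A `&` C) (A *m (c - L *m A *m c)).
    split; first by exists (c - L *m A *m c).
    by rewrite mulmxBr -mulmxA; exact: LC.
  rewrite C0 => /A_inj/eqP; rewrite subr_eq0 -colE => /eqP/matrixP/(_ i 0).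
  by rewrite !mxE eq_sym eqxx andbT => <-.
split.
  split.
    split; first by exists 0; rewrite ?mulmx0.
    by move=> _ _ [c _ <-] [d _ <-]; exists (c - d); rewrite ?mulmxBr.
  exists [set x | L *m x = 0]; split.
  - split=> /=; first by rewrite mulmx0.
    by move=> x y Lx Ly; rewrite mulmxBr Lx Ly subrr.
  - apply/seteqP; split=> [_ [[c _ <-]] /=|_ ->]; last first.
      by split=> /=; [exists 0|]; rewrite ?mulmx0.
    by rewrite mulmxA LA mul1mx => ->; rewrite mulmx0.
  - move=> x; exists (A *m (L *m x)), (x - A *m (L *m x)); split.
    + by exists (L *m x).
    + by rewrite /= mulmxBr [L *m (A *m _)]mulmxA LA mul1mx subrr.
    + by rewrite addrC subrK.
apply/eqP; rewrite eqn_leq rank_leq_col -{1}(mxrank1 rat l).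
by rewrite -(map_mx1 intr) -LA map_mxM mxrankM_maxr.
Qed.

(** Rows are indexed by all facets, and only those in [s] are constrained; this avoids enumerating
    [s] and makes restriction to a subset immediate. *)
Definition dual_basis_on n m (lam : 'M[int]_(n, m)) (s : {set 'I_m}) (L : 'M[int]_(m, n)) :=
  forall i j, i \in s -> j \in s -> (L *m lam) i j = (i == j)%:R.

Lemma summand_dual_basis n m (lam : 'M[int]_(n, m)) (s : {set 'I_m}) :
  spans_summand_of_rank #|s| (columns lam s) <-> exists L, dual_basis_on lam s L.
Proof.
apply: (iff_trans (left_inverse_summand _)); split=> [[L LA]|[L Ldual]].
  exists (\matrix_(i, k) if [pick a : 'I_#|s| | enum_val a == i] is Some a
    then L a k else 0).
  move=> i j is_ js; move: LA; rewrite mulmx_colsub.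
  move=> /matrixP/(_ (enum_rank_in is_ i) (enum_rank_in is_ j)).
  rewrite [LHS]mxE enum_rankK_in// => E.
  have -> : (i == j) = (enum_rank_in is_ i == enum_rank_in is_ j).
    by rewrite (can_in_eq (enum_rankK_in is_)).
  move: E; rewrite [in RHS]mxE => <-; rewrite !mxE; apply: eq_bigr => k _; rewrite mxE.
  case: pickP => [a /eqP ai|/(_ (enum_rank_in is_ i))]; last by rewrite enum_rankK_in// eqxx.
  by rewrite -{2}ai enum_valK_in.
exists (rowsub (fun a : 'I_#|s| => enum_val a) L).
apply/matrixP => a b; rewrite mul_rowsub_mx mulmx_colsub 2!mxE Ldual ?enum_valP//.
by rewrite mxE (inj_eq enum_val_inj).
Qed.

(** * The matrix of the simplicial wedge *)

Lemma mulmx_castmx (R : pzSemiRingType) m n n' p (e : n = n') (A : 'M[R]_(m, n)) (C : 'M[R]_(n, p)) :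
  castmx (erefl, e) A *m castmx (e, erefl) C = A *m C.
Proof. by case: n' / e; rewrite !castmx_id. Qed.

Section Wedge.
Variables (m n : nat) (J : 'I_m -> nat) (J_gt0 : forall i, (0 < J i)%N) (lam : 'M[int]_(n, m)).

Local Notation N := (dJ J - m + n)%N.
Local Notation block w := (@tagnat.sig1 m J w).
Local Notation level w := (nat_of_ord (@tagnat.sig2 m J w)).

Definition form_at (phi : 'rV[int]_N) (w : 'I_(dJ J)) : int := (phi *m lambdaJ J_gt0 lam) 0 w.

Lemma form_atB phi psi w : form_at (phi - psi) w = form_at phi w - form_at psi w.
Proof. by rewrite /form_at mulmxBl !mxE. Qed.

Lemma form_at_sum (I : finType) (Q : pred I) (a : I -> int) (phi : I -> 'rV[int]_N) w :
  form_at (\sum_(i | Q i) a i *: phi i) w = \sum_(i | Q i) a i * form_at (phi i) w.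
Proof.
rewrite /form_at mulmx_suml summxE; apply: eq_bigr => i _.
by rewrite -scalemxAl mxE.
Qed.

Lemma level_form i t : (0 < t < J i)%N -> exists phi, forall w, form_at phi w =
  if block w == i then (level w == t)%:R - (level w == 0)%:R else 0.
Proof.
case/andP=> t0 tJ; have tJ1 : (t.-1 < (J i).-1)%N by case: t (J i) t0 tJ => // t [].
(* The row with entry 1 at level [t] has index [t - 1] in its block, since level 0 has no row of its
   own. *)
pose k := @tagnat.Rank m (fun i => (J i).-1) i (Ordinal tJ1).
exists (castmx (erefl, dJ_rows J_gt0 n) (row_mx (delta_mx 0 k) 0)) => w.
rewrite /form_at /lambdaJ mulmx_castmx mul_row_col mul0mx addr0 -rowE mxE mxE mxE.
have -> : nat_of_ord (tagnat.sig2 k) = t.-1 by rewrite /k tagnat.Rank2K.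
by rewrite prednK// /k tagnat.Rank1K eq_sym.
Qed.

Lemma base_form (b : 'rV[int]_n) : exists phi, forall w, form_at phi w =
  if level w == 0 then (b *m lam) 0 (block w) else 0.
Proof.
exists (castmx (erefl, dJ_rows J_gt0 n) (row_mx 0 b)) => w.
rewrite /form_at /lambdaJ mulmx_castmx mul_row_col mul0mx add0r mxE.
case: eqP => w0; rewrite ?mxE.
  by apply: eq_bigr => k _; rewrite !mxE; case: eqP.
by apply: big1 => k _; rewrite !mxE; case: eqP; rewrite ?mulr0.
Qed.

Definition full_blocks (s : {set 'I_(dJ J)}) : {set 'I_m} :=
  [set i | [forall w : 'I_(dJ J), (block w == i) ==> (w \in s)]]%SET.

Lemma eq_block_level (v w : 'I_(dJ J)) : (v == w) = (block v == block w) && (level v == level w).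
Proof. by rewrite -tagnat.eq_Rank !tagnat.sig2K. Qed.

(** In a block with a vertex missing from [s], the zero form works if that vertex has level 0;
    otherwise minus its level form works, as its only other nonzero value on the block is at the
    missing vertex. For a full block, row [i] of [L] is spread over the level 0 columns and its
    values on the non-full blocks are cancelled by the forms just found. *)
Lemma lambdaJ_base_form s L i : dual_basis_on lam (full_blocks s) L ->
  exists phi, forall w, w \in s -> form_at phi w = ((block w == i) && (level w == 0))%:R.
Proof.
move=> Ldual.
have not_full k : k \notin full_blocks s -> exists phi, forall w, w \in s ->
    form_at phi w = ((block w == k) && (level w == 0))%:R.
  rewrite inE negb_forall => /existsP[v]; rewrite negb_imply => /andP[/eqP vk vs].
  have [v0|v0] := posnP (level v).
    exists 0 => w ws; rewrite /form_at mul0mx mxE; case: andP => // -[/eqP wk /eqP w0].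
    have vw : v = w by apply/eqP; rewrite eq_block_level v0 w0 eqxx andbT; apply/eqP; rewrite vk wk.
    by rewrite vw ws in vs.
  have [|phi phiE] := @level_form (block v) (level v); first by rewrite v0 ltn_ord.
  exists (- phi) => w ws; rewrite -[- phi]sub0r form_atB [form_at 0 _]/form_at mul0mx mxE phiE.
  rewrite -vk; have [wv|_] := boolP (block w == block v); last by rewrite subrr.
  have -> : (level w == level v) = false.
    apply: contraNF vs => lw; suff -> : v = w by [].
    by apply/eqP; rewrite eq_block_level [block v == _]eq_sym wv eq_sym.
  by rewrite sub0r sub0r opprK.
have [fi|] := boolP (i \in full_blocks s); last exact: not_full.
(* [psi] is made total with value 0 on full blocks, so that it can be summed over. *)
pose psi k := if pselect (k \notin full_blocks s) is left nk then projT1 (cid (not_full k nk)) else 0.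
have psiE k w : k \notin full_blocks s -> w \in s ->
    form_at (psi k) w = ((block w == k) && (level w == 0))%:R.
  by move=> nk ws; rewrite /psi; case: pselect => // nk'; case: cid => /= phi ->.
have [phi phiE] := base_form (row i L).
exists (phi - \sum_(k | k \notin full_blocks s) (L *m lam) i k *: psi k) => w ws.
rewrite form_atB form_at_sum phiE -row_mul mxE.
under eq_bigr => k nk do rewrite psiE//.
have [w0|_] := eqVneq (level w) 0; last first.
  by rewrite andbF big1 ?subr0// => k _; rewrite andbF mulr0.
rewrite andbT; have [fw|nfw] := boolP (block w \in full_blocks s).
  rewrite Ldual// eq_sym big1 ?subr0// => k nk.
  by case: eqP nk => [<-|]; rewrite ?fw// mulr0.
rewrite (bigD1 (block w)) //= eqxx mulr1 big1 ?addr0 ?subrr => [|k /andP[_ /negbTE]]; last first.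
  by rewrite eq_sym => ->; rewrite mulr0.
by case: eqP nfw => // ->; rewrite fi.
Qed.

(** At positive level, the level form of [v] is already dual to [v] except for the value -1 at the
    base vertex of its block; adding the base form of that block repairs this. *)
Lemma lambdaJ_dual_basis s L : dual_basis_on lam (full_blocks s) L ->
  exists L', dual_basis_on (lambdaJ J_gt0 lam) s L'.
Proof.
move=> Ldual.
have ex v : exists phi, forall w, w \in s -> form_at phi w = (v == w)%:R.
  have [th thE] := lambdaJ_base_form (block v) Ldual.
  have [v0|v0] := posnP (level v).
    by exists th => w /thE ->; rewrite eq_block_level v0 [block v == _]eq_sym [(_ == 0)%N]eq_sym.
  have [|phi phiE] := @level_form (block v) (level v); first by rewrite v0 ltn_ord.
  exists (phi - - th) => w ws; rewrite form_atB -[- th]sub0r form_atB [form_at 0 _]/form_at.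
  rewrite mul0mx mxE phiE thE// eq_block_level [block v == _]eq_sym [(level v == _)%N]eq_sym.
  by case: (block w == block v) => /=; ring.
exists (\matrix_(v, k) projT1 (cid (ex v)) 0 k) => v w vs ws.
rewrite -(projT2 (cid (ex v)) w ws) /form_at !mxE.
by apply: eq_bigr => k _; rewrite mxE.
Qed.

(** A non-simplex contains a minimal non-face, and if all its blocks are full then its blowup lies
    in [s]. *)
Lemma full_blocks_KJ (K : {set {set 'I_m}}) s : s \in KJ J K -> full_blocks s \in K.
Proof.
rewrite inE => /forallP sK; apply: contraT => fK.
have [t /minsetP[tK t_min] ts] := @minset_exists _ (fun t => t \notin K) _ fK.
have : minimal_nonface K t.
  rewrite /minimal_nonface tK; apply/forallP => u; apply/implyP => ut.
  apply: contraT => uK; have := t_min u uK (proper_sub ut) => tu.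
  by move: ut; rewrite tu fintype.properxx.
move=> /(implyP (sK t)) /negP; case; apply/fintype.subsetP => v.
rewrite inE => vt; have := fintype.subsetP ts _ vt.
by rewrite inE => /forallP/(_ v); rewrite eqxx.
Qed.

End Wedge.

(** * Toric manifolds *)

Section SimplePolytopes.
Variables (R : realType) (n m D : nat) (P : set 'rV[R]_D) (F : 'I_m -> set 'rV[R]_D).
Hypothesis P_simple : simple_polytope n P F.

(** The forms [l] come from supporting hyperplanes of the facets. The vertex [v] lies on all facets
    through [p], so [p] is in the open star of [v]; [q] inverts the coordinates at [v]. *)
Lemma simple_polytope_charts : exists l : 'I_m -> 'rV[R]_D -> R,
  [/\ forall i, continuous (l i), forall i p, P p -> 0 <= l i p,
      forall i p, P p -> F i p <-> l i p = 0
    & forall p, P p -> exists v, [/\ P v, forall i, F i p -> F i v,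
        #|facets_at F v| = n, codim_face P n n (facets_meet P F (facets_at F v))
      & forall s : 'I_n -> 'I_m, (forall i, F i v -> i \in codom s) ->
        exists q : 'rV[R]_n -> 'rV[R]_D,
          [/\ continuous q, forall p, P p -> q (\row_j l (s j) p) = p,
              forall t j, l (s j) (q t) = t 0 j
            & forall t, (forall i, 0 <= l i (q t)) -> P (q t)]]].
Proof.
have [[polyP [x0 [B [B_free Px0 PxB P_sub]]]] _ F_facet P_vertex] := P_simple.
have F_face i : face P (F i) by have [] := (F_facet (F i)).2 (ex_intro _ i erefl).
pose a i := projT1 (cid (F_face i)).
pose b i := projT1 (cid (projT2 (cid (F_face i)))).
have abP i : (forall x, P x -> 0 <= (x *m a i) 0 0 + b i) /\
    F i = P `&` [set x | (x *m a i) 0 0 + b i = 0] := projT2 (cid (projT2 (cid (F_face i)))).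
pose A : 'M[R]_(D, m) := \matrix_(k, i) a i k 0.
pose c : 'rV[R]_m := \row_i b i.
have lE i x : facet_form A c i x = (x *m a i) 0 0 + b i.
  by rewrite /facet_form !mxE; congr (_ + _); apply: eq_bigr => k _; rewrite !mxE.
have l_ge0 i p : P p -> 0 <= facet_form A c i p by rewrite lE; exact: (abP i).1.
have FE i : F i = P `&` [set p | facet_form A c i p = 0].
  by rewrite (abP i).2; apply/seteqP; split=> x [Px xF]; split=> //=; move: xF => /=; rewrite lE.
have halfspaces x : (x - x0 <= B)%MS -> (forall i, 0 <= facet_form A c i x) -> P x.
  apply: (@facet_halfspaces _ n m _ P F x0 B B_free Px0 PxB P_sub) => // [G /F_facet//|i].
  exact: affine_form_col.
exists (facet_form A c); split=> //.
- by move=> i; exact: affine_coord_continuous.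
- by move=> i p; exact: facet_form_eq0.
move=> p /(exists_rigid B_free P_sub polyP.1 l_ge0 FE halfspaces)[v [Pv pv rv]].
exists v; split=> //.
- by apply: P_vertex; exact: (rigid_vertex P_sub l_ge0 FE).
- exact: (rigid_codim_face P_sub l_ge0 FE).
move=> s vs; have s_unit := rigid_unitmx rv vs.
exists (vertex_coords_inv x0 B A c s); split.
- exact: vertex_coords_inv_continuous.
- by move=> p'; exact: vertex_coordsK.
- exact: vertex_coords_invK.
- by move=> t; apply: halfspaces; exact: vertex_coords_inv_hull.
Qed.

(** Facets with a common point are all among the facets at some vertex, and the dual family given
    there by the characteristic condition restricts to [s]. *)
Lemma simplex_dual_basis (lam : 'M[int]_(n, m)) (s : {set 'I_m}) :
  characteristic_map P F lam -> facets_meet P F s !=set0 ->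
  exists L, dual_basis_on lam s L.
Proof.
move=> lamP [p [Pp /= pF]]; have [l [_ _ _ /(_ p Pp)[v [_ pv vn codim_v _]]]] := simple_polytope_charts.
have /lamP/summand_dual_basis[L LP] : codim_face P n #|facets_at F v| (facets_meet P F (facets_at F v)).
  by rewrite vn.
exists L => i j is_ js; apply: LP; rewrite inE; apply/asboolP/pv; exact: pF.
Qed.

Lemma toric_manifold (lam : 'M[int]_(n, m)) :
  characteristic_map P F lam -> manifold R (n * 2) (toric_space P F lam).
Proof.
move=> lamP; have [l [l_cont l_ge0 l_eq0 vertices]] := simple_polytope_charts.
pose chart (s : {ffun 'I_n -> 'I_m}) (Lq : 'M[int]_n * ('rV[R]_n -> 'rV[R]_D)) :=
  [/\ Lq.1 *m colsub s lam = 1%:M, continuous Lq.2,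
      forall p, P p -> Lq.2 (\row_j l (s j) p) = p,
      forall t j, l (s j) (Lq.2 t) = t 0 j
    & forall t, (forall i, 0 <= l i (Lq.2 t)) -> P (Lq.2 t)].
(* Charts are indexed by the maps [s] that admit one, rather than by vertices, because this is
   visibly a finite type. *)
pose I := {s : {ffun 'I_n -> 'I_m} | `[< exists Lq, chart s Lq >]}.
pose Lq (i : I) := projT1 (cid (asboolW (valP i))).
have LqP i : chart (val i) (Lq i) := projT2 (cid (asboolW (valP i))).
have P_compact : compact P by have [[/polytope_compact]] := P_simple.
apply: (@toric_space_manifold R n m D P F lam l P_compact l_cont l_ge0 l_eq0 I
  (fun i => val i) (fun i => (Lq i).1) (fun i => (Lq i).2)); try by move=> i; have [] := LqP i.
move=> p Pp; have [v [Pv pv vn codim_v vq]] := vertices p Pp.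
have [L Ldual] : exists L, dual_basis_on lam (facets_at F v) L.
  apply: simplex_dual_basis => //; exists v; split=> //= i.
  by rewrite inE => /asboolP.
pose s : {ffun 'I_n -> 'I_m} := [ffun j => enum_val (cast_ord (esym vn) j)].
have s_codom i : F i v -> i \in codom s.
  move=> Fi; have iv : i \in facets_at F v by rewrite inE; exact/asboolP.
  apply/codomP; exists (cast_ord vn (enum_rank_in iv i)).
  by rewrite ffunE cast_ordK enum_rankK_in.
have [q [q1 q2 q3 q4]] := vq s s_codom.
have sP : `[< exists Lq, chart s Lq >].
  apply/asboolP; exists (rowsub s L, q); split=> //=.
  rewrite mul_rowsub_mx mulmx_colsub; apply/matrixP => j k; rewrite 2!mxE Ldual.
  - by rewrite mxE !ffunE (inj_eq enum_val_inj) (inj_eq (@cast_ord_inj _ _ _)).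
  - by rewrite ffunE enum_valP.
  - by rewrite ffunE enum_valP.
by exists (exist _ s sP) => k /pv/s_codom.
Qed.

End SimplePolytopes.

Theorem theorem3p2 (R : realType) (n m D : nat)
    (P : set 'rV[R]_D) (F : 'I_m -> set 'rV[R]_D) (K : {set {set 'I_m}})
    (lam : 'M[int]_(n, m)) (J : 'I_m -> nat) (J_gt0 : forall i, (0 < J i)%N) :
  simple_polytope n P F -> dual_to K P F ->
  characteristic_map P F lam ->
  forall (D' : nat) (PJ : set 'rV[R]_D') (FJ : 'I_(dJ J) -> set 'rV[R]_D'),
    simple_polytope (dJ J - m + n)%N PJ FJ -> dual_to (KJ J K) PJ FJ ->
    characteristic_map PJ FJ (lambdaJ J_gt0 lam) /\
    manifold R (2 * dJ J - 2 * m + 2 * n)%N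
      (toric_space PJ FJ (lambdaJ J_gt0 lam)).
Proof.
move=> P_simple P_dual lamP D' PJ FJ PJ_simple PJ_dual.
have lamJP : characteristic_map PJ FJ (lambdaJ J_gt0 lam).
  (* Having a dimension provides a point [x0] of the intersection, which makes [s] a simplex of
     [KJ J K]. *)
  move=> s [_ [d [[x0 [_ [_ sx0 _ _]]] _]]].
  have /full_blocks_KJ/P_dual s_meet : s \in KJ J K by apply/PJ_dual; exists x0.
  have [L Ldual] := simplex_dual_basis P_simple lamP s_meet.
  exact/summand_dual_basis/lambdaJ_dual_basis/Ldual.
split=> //; have := toric_manifold PJ_simple lamJP.
by rewrite mulnC mulnDr mulnBr.
Qed.
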